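(* Let $p,q,r$ be positive integers. For every $\mathbf d\in\Pi_{p,q,r}$ there exists a unique isomorphism class $I_{\mathbf d}$ of indecomposable objects in $\mathcal F_{p,q,r}$ with dimension vector $\mathbf d$. For every triple $(\mathbf a,\mathbf b,\mathbf c)\in\Lambda_{p,q,r}$ of finite type, any object in $\mathcal F_{p,q,r}$ with dimension vector $(\mathbf a,\mathbf b,\mathbf c)$ decomposes (uniquely, up to isomorphism and order of summands) into a direct sum of objects $I_{\mathbf d}$ with $\mathbf d\in\Pi_{p,q,r}$.
   Context: All vector spaces are finite-dimensional over a fixed algebraically closed field. A composition is a list $\mathbf a=(a_1,\ldots,a_p)$ of nonnegative integers (zero parts allowed); $|\mathbf a|=a_1+\cdots+a_p$, $\|\mathbf a\|^2=a_1^2+\cdots+a_p^2$, $\ell(\mathbf a)=p$. For $\dim V=|\mathbf a|$, $\mathrm{Fl}_{\mathbf a}(V)$ is the variety of flags $A=(0=A_0\subset A_1\subset\cdots\subset A_p=V)$ with $\dim(A_i/A_{i-1})=a_i$. $\Lambda_{p,q,r}$ is the additive semigroup of triples of compositions $(\mathbf a,\mathbf b,\mathbf c)$ with $(\ell(\mathbf a),\ell(\mathbf b),\ell(\mathbf c))=(p,q,r)$ and $|\mathbf a|=|\mathbf b|=|\mathbf c|$. A triple is of finite type if $GL(V)$, acting diagonally, has finitely many orbits in $\mathrm{Fl}_{\mathbf a}(V)\times\mathrm{Fl}_{\mathbf b}(V)\times\mathrm{Fl}_{\mathbf c}(V)$, $\dim V=|\mathbf a|$. The Tits form is $Q(\mathbf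 a,\mathbf b,\mathbf c)=\dim GL(V)-\dim\mathrm{Fl}_{\mathbf a}(V)-\dim\mathrm{Fl}_{\mathbf b}(V)-\dim\mathrm{Fl}_{\mathbf c}(V)=\tfrac12(\|\mathbf a\|^2+\|\mathbf b\|^2+\|\mathbf c\|^2-|\mathbf a|^2)$. $\Pi_{p,q,r}$ is the set of all $\mathbf d\in\Lambda_{p,q,r}$ of finite type with $Q(\mathbf d)=1$. $\mathcal F_{p,q,r}$ is the additive category whose objects are $(V;A,B,C)$ with $V$ a finite-dimensional vector space and $(A,B,C)\in\mathrm{Fl}_{\mathbf a}(V)\times\mathrm{Fl}_{\mathbf b}(V)\times\mathrm{Fl}_{\mathbf c}(V)$ for some $(\mathbf a,\mathbf b,\mathbf c)\in\Lambda_{p,q,r}$, called the dimension vector of the object; a morphism $(V;A,B,C)\to(V';A',B',C')$ is a linear map $f:V\to V'$ with $f(A_i)\subset A_i'$, $f(B_i)\subset B_i'$, $f(C_i)\subset C_i'$ for all $i$; direct sums are taken componentwise on each member of each flag. *)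

(* Defs.v *)
From HB Require Import structures.
From mathcomp Require Import all_boot all_order all_algebra.

Set Implicit Arguments.
Unset Strict Implicit.
Unset Printing Implicit Defensive.

Import GRing.Theory.

Local Open Scope ring_scope.

Section Compositions.

Variables p q r : nat.

Definition csize n (a : n.-tuple nat) : nat := (\sum_(x <- a) x)%N.
Definition cnormsq n (a : n.-tuple nat) : nat := (\sum_(x <- a) x ^ 2)%N.

Definition triple : Type := (p.-tuple nat * q.-tuple nat * r.-tuple nat)%type.

Definition Lambda (d : triple) : Prop :=
  csize d.1.1 = csize d.1.2 /\ csize d.1.2 = csize d.2.

(* dim GL(V) - dim Fl_a(V) - dim Fl_b(V) - dim Fl_c(V) for dim V = |a|, using
   dim Fl_a(V) = (|a|^2 - ||a||^2) / 2; rational-valued because of the 1/2. *)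
Definition tits (d : triple) : rat :=
  2^-1 * ((cnormsq d.1.1)%:R + (cnormsq d.1.2)%:R + (cnormsq d.2)%:R
          - (csize d.1.1)%:R ^+ 2).

End Compositions.

Section Flags.

Variables (K : fieldType) (V : vectType K) (p : nat).

(* For i : 'I_p, the consecutive members A_i and A_{i+1} are indexed by
   widen_ord (leqnSn p) i and lift ord0 i. *)
Definition is_flag (A : {ffun 'I_p.+1 -> {vspace V}}) : bool :=
  [&& A ord0 == 0%VS, A ord_max == fullv
    & [forall i : 'I_p, (A (widen_ord (leqnSn p) i) <= A (lift ord0 i))%VS]].

Record flag : Type := Flag {
  flag_val :> {ffun 'I_p.+1 -> {vspace V}};
  flagP : is_flag flag_val }.

HB.instance Definition _ := [isSub for flag_val].
HB.instance Definition _ := [Choice of flag by <:].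

Lemma flag_ord0 (A : flag) : A ord0 = 0%VS.
Proof. by case/and3P: (flagP A) => /eqP. Qed.

Lemma flag_ord_max (A : flag) : A ord_max = fullv.
Proof. by case/and3P: (flagP A) => _ /eqP. Qed.

Lemma flag_nested (A : flag) (i : 'I_p) :
  (A (widen_ord (leqnSn p) i) <= A (lift ord0 i))%VS.
Proof. by case/and3P: (flagP A) => _ _ /forallP. Qed.

(* The subtraction never truncates: the members of a flag are nested. *)
Definition flag_type (A : flag) : p.-tuple nat :=
  [tuple (\dim (A (lift ord0 i)) - \dim (A (widen_ord (leqnSn p) i)))%N | i < p].

End Flags.

Section FlagSum.

Variables (K : fieldType) (V W : vectType K).

Definition vsum (U : {vspace V}) (U' : {vspace W}) : {vspace (V * W)%type} :=
  (linfun (@fst V W) @^-1: U :&: linfun (@snd V W) @^-1: U')%VS.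

Lemma mem_vsum U U' x : (x \in vsum U U') = (x.1 \in U) && (x.2 \in U').
Proof. by rewrite memv_cap -!memv_preim !lfunE. Qed.

Variable p : nat.

Definition flag_sum_val (A : flag V p) (B : flag W p) :
    {ffun 'I_p.+1 -> {vspace (V * W)%type}} :=
  [ffun i => vsum (A i) (B i)].

Lemma flag_sum_subproof A B : is_flag (flag_sum_val A B).
Proof.
apply/and3P; split; rewrite ?ffunE /=.
- apply/eqP/vspaceP => -[x y].
  by rewrite mem_vsum /= !flag_ord0 !memv0 -pair_eqE.
- by apply/eqP/vspaceP => x; rewrite mem_vsum !flag_ord_max !memvf.
apply/forallP => i; rewrite !ffunE /=; apply/subvP => x; rewrite !mem_vsum.
by case/andP=> /(subvP (flag_nested A i)) -> /(subvP (flag_nested B i)) ->.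
Qed.

Definition flag_sum (A : flag V p) (B : flag W p) : flag (V * W)%type p :=
  Flag (flag_sum_subproof A B).

End FlagSum.

Section ZeroFlag.

Variables (K : fieldType) (p : nat).

Lemma flag_zero_subproof :
  is_flag ([ffun=> 0%VS] : {ffun 'I_p.+1 -> {vspace 'rV[K]_0}}).
Proof.
apply/and3P; split; rewrite ?ffunE ?eqxx //.
  by apply/eqP/vspaceP => x; rewrite (thinmx0 x) !mem0v.
by apply/forallP => i; rewrite !ffunE sub0v.
Qed.

Definition flag_zero : flag 'rV[K]_0 p := Flag flag_zero_subproof.

End ZeroFlag.

Definition mutually_inverse (K : fieldType) (V W : vectType K)
    (f : 'Hom(V, W)) (g : 'Hom(W, V)) : Prop :=
  (g \o f)%VF = \1%VF /\ (f \o g)%VF = \1%VF.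

Section FiniteType.

Variables (K : fieldType) (p q r : nat).

Definition flag_moved (V : vectType K) n (g : 'End(V)) (A B : flag V n) : Prop :=
  forall i, (g @: A i)%VS = B i.

Definition same_orbit (V : vectType K)
    (t u : flag V p * flag V q * flag V r) : Prop :=
  exists g h : 'End(V),
    [/\ mutually_inverse g h, flag_moved g t.1.1 u.1.1,
        flag_moved g t.1.2 u.1.2 & flag_moved g t.2 u.2].

Definition in_Fl (V : vectType K) (d : triple p q r)
    (t : flag V p * flag V q * flag V r) : Prop :=
  [/\ flag_type t.1.1 = d.1.1, flag_type t.1.2 = d.1.2 & flag_type t.2 = d.2].

(* Only meaningful together with Lambda d: otherwise the product of flag
   varieties is empty and the condition holds trivially. *)
Definition finite_type (d : triple p q r) : Prop :=
  forall V : vectType K, \dim {:V} = csize d.1.1 ->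
  exists s : seq (flag V p * flag V q * flag V r),
    forall t, in_Fl d t -> exists2 u, u \in s & same_orbit u t.

Definition Pi (d : triple p q r) : Prop :=
  [/\ Lambda d, finite_type d & tits d = 1].

End FiniteType.

Section Category.

Variables (K : fieldType) (p q r : nat).

Record obj : Type := Obj {
  carrier :> vectType K;
  flagA : flag carrier p;
  flagB : flag carrier q;
  flagC : flag carrier r }.

Definition dimvec (X : obj) : triple p q r :=
  (flag_type (flagA X), flag_type (flagB X), flag_type (flagC X)).

Definition is_morphism (X Y : obj) (f : 'Hom(X, Y)) : Prop :=
  [/\ forall i, (f @: flagA X i <= flagA Y i)%VS,
      forall i, (f @: flagB X i <= flagB Y i)%VS
    & forall i, (f @: flagC X i <= flagC Y i)%VS].

Definition iso (X Y : obj) : Prop :=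
  exists (f : 'Hom(X, Y)) (g : 'Hom(Y, X)),
    [/\ is_morphism f, is_morphism g & mutually_inverse f g].

Definition zero_obj : obj :=
  Obj (flag_zero K p) (flag_zero K q) (flag_zero K r).

Definition sum_obj (X Y : obj) : obj :=
  Obj (flag_sum (flagA X) (flagA Y)) (flag_sum (flagB X) (flagB Y))
      (flag_sum (flagC X) (flagC Y)).

Definition direct_sum (s : seq obj) : obj := foldr sum_obj zero_obj s.

Definition indecomposable (X : obj) : Prop :=
  ~ iso X zero_obj /\
  forall Y Z : obj, iso X (sum_obj Y Z) -> iso Y zero_obj \/ iso Z zero_obj.

End Category.

(* In particular the dimension vector of any object lies in Lambda. *)
Lemma csize_flag_type (K : fieldType) (V : vectType K) p (A : flag V p) :
  csize (flag_type A) = \dim {:V}.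
Proof.
rewrite /csize big_tuple; under eq_bigr do rewrite tnth_mktuple /=.
pose F n : nat := \dim (A (inord n)).
transitivity (\sum_(0 <= i < p) (F i.+1 - F i))%N.
  rewrite big_mkord; apply: eq_bigr => i _; rewrite /F.
  by congr (\dim (A _) - \dim (A _))%N; apply/val_inj;
    rewrite /= ?lift0 inordK // ltnS // ltnW.
rewrite telescope_sumn_in // => [|i /andP[_ ip]]; rewrite /F.
  have -> : inord p = ord_max :> 'I_p.+1 by apply/val_inj; rewrite /= inordK.
  have -> : inord 0 = ord0 :> 'I_p.+1 by apply/val_inj; rewrite /= inordK.
  by rewrite flag_ord0 flag_ord_max dimv0 subn0.
have := dimvS (flag_nested A (Ordinal ip)).
by congr (\dim (A _) <= \dim (A _))%N; apply/val_inj;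
  rewrite /= ?lift0 inordK // ltnS // ltnW.
Qed.

(* Main.v *)
From HB Require Import structures.
Require Import Defs.
From mathcomp Require Import all_boot all_order all_algebra.
From mathcomp Require Import zify lra.
From Stdlib Require List.
From Stdlib Require Import Classical IndefiniteDescription.

Set Implicit Arguments.
Unset Strict Implicit.
Unset Printing Implicit Defensive.

Import GRing.Theory passmx.

Local Open Scope ring_scope.

                                                             

(** For an object X on a space V of dimension n, consider the linear map [mismatch] that sends a
    triple (a,b,c) of endomorphisms of V, each preserving one of the three flags, to (a-b, b-c) in
    End(V)^2. Its kernel is End(X) and its cokernel plays the part of Ext^1(X,X). The endomorphisms
    preserving a flag of type a have dimension (n^2 + ||a||^2)/2 ([dim_homs]), so the dimension of
    the kernel minus that of the cokernel is the Tits form Q. Call X rigid if the map is onto; then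
    dim End(X) = Q.

    Three facts carry the theorem. (1) Every finite-type dimension vector of an object is that of a
    rigid object ([rigid_exists]). Among all flags of that type take some minimizing the sum of dim
    Hom from the finitely many orbit representatives. No generic deformation changes these
    dimensions, and the first-order consequence of this is surjectivity of [mismatch]. (2) Rigid
    objects with equal dimension vectors are isomorphic ([rigid_unique]): join them by a pencil,
    whose generic members are isomorphic to both ends. (3) An indecomposable X of finite type is
    rigid with Q = 1 ([indecomposable_rigid]). By induction smaller indecomposables of finite type
    are rigid; an argument in the manner of Ringel ([no_square_zero_endo]) then gives End(X) = K.
    For a rigid Y with the same dimension vector, 1 <= dim End(Y) = Q <= dim End(X) = 1, which
    forces equality and rigidity of X.

    For d in Pi the rigid object of (1) has a one-dimensional endomorphism space, so it is
    indecomposable, and (2) and (3) make it unique. For decompositions, Fitting's lemma and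
    cancellation give the Krull-Schmidt theorem. Cancellation also shows that finite type passes to
    summands ([finite_type_summand]), so by (3) every indecomposable summand is some I_d. All the
    geometry used is that a nonzero polynomial in one variable over K has a nonroot. *)

Lemma dim_lker_limg (K : fieldType) (U W : vectType K) (f : 'Hom(U, W)) :
  (\dim (lker f) + \dim (limg f))%N = \dim {:U}.
Proof. by rewrite -(limg_ker_dim f {:U}) capfv. Qed.

(** * Generic members of linear pencils: semicontinuity along a line *)

Section Generic.

Variable K : closedFieldType.

(** Replaces Zariski density on the affine line. Two such properties hold simultaneously somewhere,
    because the product of two nonzero polynomials has a nonroot. *)
Definition generic (P : K -> Prop) : Prop :=
  exists2 g : {poly K}, g != 0 & forall t, ~~ root g t -> P t.

Lemma generic_ex P : generic P -> exists t, P t.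
Proof. by case=> g /closed_nonrootP[t gt] gP; exists t; apply: gP. Qed.

Lemma generic_imp (P Q : K -> Prop) :
  (forall t, P t -> Q t) -> generic P -> generic Q.
Proof. by move=> PQ [g g0 gP]; exists g => // t /gP/PQ. Qed.

Lemma generic_and (P Q : K -> Prop) :
  generic P -> generic Q -> generic (fun t => P t /\ Q t).
Proof.
move=> [g g0 gP] [h h0 hQ]; exists (g * h); first by rewrite mulf_neq0.
by move=> t; rewrite rootM negb_or => /andP[/gP ? /hQ].
Qed.

Lemma generic_all (T : eqType) (s : seq T) (P : T -> K -> Prop) :
  (forall u, u \in s -> generic (P u)) ->
  generic (fun t => forall u, u \in s -> P u t).
Proof.
elim: s => [_|x s IHs sP].
  by exists 1; [exact: oner_neq0 | move=> ? _ ?; rewrite in_nil].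
have Ps: generic (fun t => forall u, u \in s -> P u t).
  by apply: IHs => u us; apply: sP; rewrite inE us orbT.
apply: generic_imp (generic_and (sP x (mem_head _ _)) Ps).
by move=> t [Px Pt] u; rewrite inE => /predU1P[->|/Pt].
Qed.

Lemma generic_neq (a : K) : generic (fun t => t != a).
Proof.
by exists ('X - a%:P); [by rewrite polyXsubC_eq0 | move=> t;
  rewrite root_XsubC].
Qed.

(** Lets a pencil be examined from its end at 1 as well as from its end at 0. *)
Lemma generic_flip (P : K -> Prop) :
  generic P -> generic (fun t => P (1 - t)).
Proof.
case=> g g0 gP; exists (g \Po (1 - 'X)).
  rewrite comp_poly2_eq0 //; rewrite -opprB size_polyN.
  by rewrite -polyC1 size_XsubC.
by move=> t; rewrite /root horner_comp !hornerE => /gP.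
Qed.

Lemma generic_unitmx n (M : 'M[{poly K}]_n) :
  map_mx (horner_eval 0) M \in unitmx ->
  generic (fun t => map_mx (horner_eval t) M \in unitmx).
Proof.
rewrite unitmxE det_map_mx unitfE => M0; exists (\det M).
  by apply: contraNneq M0 => ->; rewrite rmorph0.
by move=> t; rewrite unitmxE det_map_mx unitfE.
Qed.

Lemma lker0_mxof (V : vectType K) (f : 'End(V)) :
  (lker f == 0%VS) =
  (mxof (vbasis {:V}) (vbasis {:V}) f \in unitmx).
Proof.
by rewrite (lker_ker (vbasisP _)) vsof_eq0 ?vbasisP // kermx_eq0 row_free_unit.
Qed.

                                                                       
                                                                           
(** Since [M0] is onto, the kernel vector [v] extends to a polynomial curve of kernel vectors of
    [M0 + t *: M1]. Invertibility of [L] along that curve is the nonvanishing of a polynomial that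
    is nonzero at 0. *)
Lemma generic_section (U W E : vectType K) (M0 M1 : 'Hom(U, W))
    (L : 'Hom(U, 'End(E))) v :
  limg M0 = fullv -> M0 v = 0 -> lker (L v) == 0%VS ->
  generic (fun t => exists2 w, (M0 + t *: M1) w = 0 & lker (L w) == 0%VS).
Proof.
move=> M0s M0v Lv.
pose eU := vbasis {:U}; pose eW := vbasis {:W}; pose eE := vbasis {:E}.
have eUb : basis_of {:U} eU by exact: vbasisP.
have eWb : basis_of {:W} eW by exact: vbasisP.
pose A0 := mxof eU eW M0; pose A1 := mxof eU eW M1.
pose N := mxof eW eU (M0^-1)%VF.
have NA0 : N *m A0 = 1%:M.
  rewrite -mxof_comp // -(mxof1 (basis_free eWb)); congr mxof.
  by apply/lfunP => w; rewrite comp_lfunE limg_lfunVK ?id_lfunE // M0s memvf.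
pose x := rVof eU v.
have xA0 : x *m A0 = 0 by rewrite mul_mxof rVofK // ?memvf // M0v linear0.
(* With row vectors, [N] is a left factor inverting [A0], so N(A0 + tA1) = S(t). *)
pose S : 'M[{poly K}]_(\dim {:W}) := 1%:M + 'X *: map_mx polyC (N *m A1).
(* The correction x - t x A1 S(t)^-1 N of [x] lies in the kernel; multiplying by det S clears
   denominators. At 0 the value is [x]. *)
pose w := \det S *: map_mx polyC x -
  'X *: (map_mx polyC (x *m A1) *m \adj S *m map_mx polyC N).
pose ev t := map_mx (horner_eval t) : 'rV[{poly K}]_(\dim {:U}) -> _.
have evC t m n (A : 'M[K]_(m, n)) : map_mx (horner_eval t) (map_mx polyC A) = A.
  by apply/matrixP => i j; rewrite !mxE /horner_eval hornerC.
have evX t m n (A : 'M[{poly K}]_(m, n)) :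
    map_mx (horner_eval t) ('X *: A) = t *: map_mx (horner_eval t) A.
  by apply/matrixP => i j; rewrite !mxE /horner_eval hornerM hornerX.
have evZ t m n p (A : 'M[{poly K}]_(m, n)) :
    map_mx (horner_eval t) (p *: A) = p.[t] *: map_mx (horner_eval t) A.
  by apply/matrixP => i j; rewrite !mxE /horner_eval hornerM.
have evS t : map_mx (horner_eval t) S = 1%:M + t *: (N *m A1).
  by rewrite map_mxD evX evC map_mx1.
have w0 : ev 0 w = x.
  rewrite /ev raddfB /= evZ evX scale0r subr0 evC.
  rewrite -[_.[_]](det_map_mx (horner_eval 0)) evS.
  by rewrite scale0r addr0 det1 scale1r.
have wt t : ev t w *m (A0 + t *: A1) = 0.
  have ND : N *m (A0 + t *: A1) = 1%:M + t *: (N *m A1).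
    by rewrite mulmxDr NA0 -scalemxAr.
  rewrite /ev raddfB /= evZ evX evC !map_mxM !evC map_mx_adj.
  rewrite -[_.[_]](det_map_mx (horner_eval t)) evS mulmxBl -!scalemxAl.
  rewrite -[_ *m N *m _]mulmxA ND -[_ *m \adj _ *m _]mulmxA mul_adj_mx.
  rewrite mul_mx_scalar mulmxDr.
  by rewrite xA0 add0r -scalemxAr scalerA mulrC -scalerA scalerA subrr.
pose F u := mxof eE eE (L u).
pose B : 'M[{poly K}]_(\dim {:E}) :=
  \sum_i w 0 i *: map_mx polyC (F eU`_i).
have evB t : map_mx (horner_eval t) B = F (vecof eU (ev t w)).
  rewrite /B /F /vecof [LHS]raddf_sum.
  rewrite (linear_sum L) (linear_sum (mxof eE eE)) /=; apply: eq_bigr => i _.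
  have wi : (w 0 i).[t] = ev t w 0 i by rewrite [RHS]mxE.
  by rewrite [LHS]evZ evC wi !linearZ.
have B0 : map_mx (horner_eval 0) B \in unitmx.
  by rewrite evB w0 rVofK // -lker0_mxof.
apply: generic_imp (generic_unitmx B0) => t; rewrite evB -lker0_mxof => Lt.
exists (vecof eU (ev t w)) => //.
have := congr1 (vecof eW) (wt t); rewrite linear0 mulmxDr linearD /=.
by rewrite -scalemxAr linearZ /= -!hom_vecof // add_lfunE scale_lfunE.
Qed.

Lemma generic_lker0 (V : vectType K) (f g : 'End(V)) :
  lker f == 0%VS -> generic (fun t => lker (f + t *: g) == 0%VS).
Proof.
pose e := vbasis {:V}; rewrite lker0_mxof => f0.
pose M : 'M[{poly K}]_(\dim {:V}) :=
  map_mx polyC (mxof e e f) + 'X *: map_mx polyC (mxof e e g).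
have evM t : map_mx (horner_eval t) M = mxof e e (f + t *: g).
  rewrite linearD linearZ; apply/matrixP => i j.
  by rewrite !mxE /horner_eval hornerD hornerM hornerX !hornerC.
have [|h h0 hP] := @generic_unitmx _ M; first by rewrite evM scale0r addr0.
by exists h => // t /hP; rewrite evM lker0_mxof.
Qed.

(** Lower semicontinuity of rank. With [p] a projection onto the image of f, the map p(f + tg)f^-1
    acts on that image as 1 + t p g f^-1, which is injective for generic t. *)
Lemma generic_dim_limg (U W : vectType K) (f g : 'Hom(U, W)) :
  generic (fun t => \dim (limg f) <= \dim (limg (f + t *: g)%R))%N.
Proof.
pose p := projv (limg f).
have ffp w : f (f^-1%VF (p w)) = p w by rewrite limg_lfunVK ?memv_proj.
have i0 : lker (\1%VF : 'End(W)) == 0%VS.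
  by apply/lker0P => x y; rewrite !id_lfunE.
apply: generic_imp (generic_lker0 (p \o g \o f^-1 \o p)%VF i0) => t /lker0P inj.
rewrite -(@limg_dim_eq _ _ _ ((f + t *: g) \o f^-1)%VF (limg f)).
  by rewrite limg_comp dimvS // limgS // subvf.
apply/eqP; rewrite -subv0; apply/subvP => w /memv_capP[wf].
rewrite memv_ker comp_lfunE => /eqP ww; rewrite memv0; apply/eqP/inj.
have pw : p w = w by exact: projv_id.
rewrite linear0 !(add_lfunE, scale_lfunE, comp_lfunE, id_lfunE) pw.
have := congr1 p ww; rewrite add_lfunE scale_lfunE linearD linearZ /=.
by have := ffp w; rewrite pw => ->; rewrite pw linear0.
Qed.

                                                                            
                                                                              
                        
(** First-order form of constancy: if the kernel of f + tg does not shrink generically, the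
    obstruction [g v] to deforming a kernel vector [v] vanishes modulo the image of [f]. *)
Lemma generic_ker_pencil (U W : vectType K) (f g : 'Hom(U, W)) v :
  generic (fun t => \dim (lker f) <= \dim (lker (f + t *: g)%R))%N ->
  f v = 0 -> g v \in limg f.
Proof.
move=> fg fv.
(* The image of [C0] is that of f together with the line of [g v]; it suffices that its rank is at
   most that of f. *)
pose C0 : 'Hom((U * U)%type, W) := ((f \o linfun (@fst U U)) +
  (g \o projv <[v]> \o linfun (@snd U U)))%VF.
pose C1 := (g \o linfun (@fst U U))%VF.
have C0E x : C0 x = f x.1 + g (projv <[v]> x.2).
  by rewrite add_lfunE !comp_lfunE !lfunE.
have [t [[t0 fgt] C0t]] := generic_ex (generic_and (generic_and
  (generic_neq 0) fg) (generic_dim_limg C0 C1)).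
have C0lim : (limg f <= limg C0)%VS.
  apply/subvP => _ /memv_imgP[u _ ->].
  by apply/memv_imgP; exists (u, 0); rewrite ?memvf // C0E !linear0 addr0.
(* As f v = 0 and t is nonzero, a g(v) = (f + tg)((a/t)v): away from 0 the extra line is already in
   the image of the pencil. *)
have limt : (limg (C0 + t *: C1)%R <= limg (f + t *: g)%R)%VS.
  apply/subvP => _ /memv_imgP[[u u'] _ ->]; apply/memv_imgP.
  have /vlineP[a va] := memv_proj <[v]> u'.
  exists (u + (a / t) *: v); rewrite ?memvf //.
  rewrite add_lfunE C0E scale_lfunE comp_lfunE lfunE /= va add_lfunE
    scale_lfunE.
  rewrite !linearD !linearZ /= fv scaler0 addr0 scalerA divfK //.
  by rewrite -addrA [a *: _ + _]addrC.
have dimt : (\dim (limg (f + t *: g)%R) <= \dim (limg f))%N.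
  rewrite -(leq_add2l (\dim (lker f))) dim_lker_limg.
  by rewrite -(dim_lker_limg (f + t *: g)) leq_add2r.
have /eqP-> : limg f == limg C0.
  by rewrite eqEdim C0lim (leq_trans C0t) // (leq_trans (dimvS limt)).
apply/memv_imgP; exists (0, v); rewrite ?memvf // C0E linear0 add0r.
by rewrite projv_id ?memv_line.
Qed.
End Generic.

                                          

(** * Linear maps into and out of a product of two spaces *)

Lemma linfun_linear (K : fieldType) (U W : vectType K) (F : U -> W) :
  linear F -> linfun F =1 F.
Proof.
move=> linF.
pose L : {linear U -> W} :=
  HB.pack F (GRing.isSemilinear.Build K U W _ F (GRing.semilinear_linear linF)).
exact: (lfunE L).
Qed.

Section PairMaps.

Variables (K : fieldType) (U V W : vectType K).

Definition pfst : 'Hom((V * W)%type, V) := linfun (@fst V W).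
Definition psnd : 'Hom((V * W)%type, W) := linfun (@snd V W).
Definition ppair (f : 'Hom(U, V)) (g : 'Hom(U, W)) : 'Hom(U, (V * W)%type) :=
  linfun (fun u => (f u, g u)).

Lemma pfstE x : pfst x = x.1. Proof. exact: lfunE. Qed.
Lemma psndE x : psnd x = x.2. Proof. exact: lfunE. Qed.
Lemma ppairE f g u : ppair f g u = (f u, g u).
Proof. by rewrite linfun_linear // => a x y; rewrite !linearP. Qed.

Lemma dim_vsum (A : {vspace V}) (B : {vspace W}) :
  \dim (vsum A B) = (\dim A + \dim B)%N.
Proof.
rewrite -(limg_ker_dim pfst (vsum A B)) addnC; congr (_ + _)%N.
  congr (\dim _); apply/vspaceP => v; apply/memv_imgP/idP.
    by case=> x; rewrite mem_vsum => /andP[xA _] ->; rewrite pfstE.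
  by move=> vA; exists (v, 0); rewrite ?pfstE // mem_vsum vA mem0v.
rewrite -(@limg_dim_eq _ _ _ psnd).
  congr (\dim _); apply/vspaceP => w; apply/memv_imgP/idP.
    by case=> x /memv_capP[]; rewrite mem_vsum => /andP[_ xB] _ ->;
      rewrite psndE.
  move=> wB; exists (0, w); rewrite ?psndE //.
  by rewrite memv_cap mem_vsum mem0v wB memv_ker pfstE eqxx.
apply/eqP; rewrite -subv0; apply/subvP => -[v w].
rewrite !memv_cap !memv_ker pfstE psndE /= => /andP[/andP[_ /eqP->] /eqP->].
exact: mem0v.
Qed.

End PairMaps.

(** * Maps preserving flags; flags pushed along surjections and pulled along injections *)

Section Flags.

Variables (K : fieldType) (p : nat).
Implicit Types U V W : vectType K.

Lemma flag_mono V (A : flag V p) (i j : 'I_p.+1) :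
  (i <= j)%N -> (A i <= A j)%VS.
Proof.
case: i => i ip /=; elim: (j : nat) {-2}j (erefl (j : nat)) =>
  {j} [|n IHn] j jE.
  rewrite jE leqn0 => /eqP i0.
  by rewrite (_ : Ordinal ip = j) //; apply/val_inj; rewrite /= i0 jE.
rewrite jE leq_eqVlt => /predU1P[in1|].
  by rewrite (_ : Ordinal ip = j) //; apply/val_inj; rewrite /= in1 jE.
rewrite ltnS => ile; have np : (n < p)%N by rewrite -ltnS -jE.
have := flag_nested A (Ordinal np).
rewrite (_ : lift _ _ = j); last by apply/val_inj; rewrite /= jE.
by apply: subv_trans; apply: IHn.
Qed.

Lemma flag_type_dim V W (A : flag V p) (B : flag W p) :
  flag_type A = flag_type B -> forall i, \dim (A i) = \dim (B i).
Proof.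
move=> AB; case=> i; elim: i => [|i IHi] ip.
  by rewrite (_ : Ordinal ip = ord0) ?flag_ord0 ?dimv0 //; apply/val_inj.
have ip' : (i < p)%N by [].
have := congr1 (fun t => tnth t (Ordinal ip')) AB; rewrite !tnth_mktuple.
have := dimvS (flag_nested A (Ordinal ip')).
have := dimvS (flag_nested B (Ordinal ip')).
rewrite (_ : lift _ _ = Ordinal ip); last exact/val_inj.
rewrite (_ : widen_ord _ _ = Ordinal (ltnW ip)); last exact/val_inj.
by rewrite IHi => /subnK {2}<- /subnK {2}<- ->.
Qed.

Lemma eq_flag_type V W (A : flag V p) (B : flag W p) :
  (forall i, \dim (A i) = \dim (B i)) -> flag_type A = flag_type B.
Proof. by move=> AB; apply: eq_from_tnth => i; rewrite !tnth_mktuple !AB. Qed.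

Definition preserves V W (f : 'Hom(V, W)) (A : flag V p) (B : flag W p) :=
  forall i u, u \in A i -> f u \in B i.

Lemma preservesP V W (f : 'Hom(V, W)) (A : flag V p) (B : flag W p) :
  (forall i, (f @: A i <= B i)%VS) <-> preserves f A B.
Proof.
split=> [fAB i u uA|fAB i]; first exact: (subvP (fAB i)) (memv_img f uA).
by apply/subvP => _ /memv_imgP[u /fAB uB ->].
Qed.

Definition sandwich V W V' W' (a : 'Hom(W, W')) (b : 'Hom(V', V))
  (f : 'Hom(V, W)) : 'Hom(V', W') := (a \o f \o b)%VF.

Lemma sandwich_linear V W V' W' (a : 'Hom(W, W')) (b : 'Hom(V', V)) :
  linear (sandwich a b).
Proof.
move=> k f g; apply/lfunP => x.
by rewrite !(comp_lfunE, add_lfunE, scale_lfunE) linearP.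
Qed.

(** Each condition f(A_i) in B_i is written as the vanishing of (1 - proj B_i) f (proj A_i), linear
    in f, so that the result is a subspace with a dimension. *)
Definition homs V W (A : flag V p) (B : flag W p) : {vspace 'Hom(V, W)} :=
  (\bigcap_i lker (linfun (sandwich (\1%VF - projv (B i))%R (projv (A i)))))%VS.

Lemma memv_homs V W (A : flag V p) (B : flag W p) f :
  reflect (preserves f A B) (f \in homs A B).
Proof.
have homE i : reflect (forall u, u \in A i -> f u \in B i)
    (f \in lker (linfun (sandwich (\1%VF - projv (B i)) (projv (A i))))).
  rewrite memv_ker linfun_linear; last exact: sandwich_linear.
  apply: (iffP eqP) => [f0 u uA|fAB].
    have := congr1 (fun h : 'Hom(V, W) => h u) f0.
    rewrite !(comp_lfunE, add_lfunE, opp_lfunE, id_lfunE, zero_lfunE).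
    by rewrite projv_id // => /eqP; rewrite subr_eq0 => /eqP->;
      apply: memv_proj.
  apply/lfunP => u.
  rewrite !(comp_lfunE, add_lfunE, opp_lfunE, id_lfunE, zero_lfunE).
  by rewrite [projv (B i) _]projv_id ?subrr // fAB // memv_proj.
apply: (iffP idP) => [fh i|fAB].
  by apply/homE; move: fh; rewrite memvE => /subv_bigcapP/(_ i isT).
by rewrite memvE; apply/subv_bigcapP => i _; rewrite -memvE; apply/homE/fAB.
Qed.

Lemma flag_push_subproof V W (A : flag V p) (g : 'Hom(V, W)) :
  limg g = fullv -> is_flag [ffun i => (g @: A i)%VS].
Proof.
move=> gs; apply/and3P; split; rewrite ?ffunE.
- by rewrite flag_ord0 limg0.
- by rewrite flag_ord_max gs.
by apply/forallP => i; rewrite !ffunE limgS ?flag_nested.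
Qed.

Definition flag_push V W (A : flag V p) (g : 'Hom(V, W)) (gs : limg g = fullv) :
  flag W p := Flag (flag_push_subproof A gs).

Lemma flag_pull_subproof V W (A : flag W p) (g : 'Hom(V, W)) :
  lker g = 0%VS -> is_flag [ffun i => (g @^-1: A i)%VS].
Proof.
move=> gi; apply/and3P; split; rewrite ?ffunE.
- by rewrite flag_ord0 lpreim0 gi.
- rewrite flag_ord_max; apply/eqP/vspaceP => v.
  by rewrite -memv_preim !memvf.
by apply/forallP => i; rewrite !ffunE lpreimS ?flag_nested.
Qed.

Definition flag_pull V W (A : flag W p) (g : 'Hom(V, W)) (gi : lker g = 0%VS) :
  flag V p := Flag (flag_pull_subproof A gi).

Lemma memv_flag_pull V W (A : flag W p) (g : 'Hom(V, W)) (gi :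
  lker g = 0%VS) i v :
  (v \in flag_pull A gi i) = (g v \in A i).
Proof. by rewrite ffunE -memv_preim. Qed.

Lemma memv_flag_sum V W (A : flag V p) (B : flag W p) i x :
  (x \in flag_sum A B i) = (x.1 \in A i) && (x.2 \in B i).
Proof. by rewrite ffunE mem_vsum. Qed.

Lemma dim_flag_sum V W (A : flag V p) (B : flag W p) i :
  \dim (flag_sum A B i) = (\dim (A i) + \dim (B i))%N.
Proof. by rewrite ffunE dim_vsum. Qed.

(** Subobject and quotient flags of a short exact sequence have additive dimensions, by rank-nullity
    for [g] on each member. Hence an extension has the dimension vector of the direct sum. *)
Lemma dim_flag_exact U V W (i : 'Hom(U, V)) (g : 'Hom(V, W)) (A : flag V p)
    (ii : lker i = 0%VS) (gs : limg g = fullv) j :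
  limg i = lker g ->
  \dim (A j) = (\dim (flag_pull A ii j) + \dim (flag_push A gs j))%N.
Proof.
move=> ig; rewrite -(limg_ker_dim g (A j)) !ffunE; congr (_ + _)%N.
rewrite -ig -lpreim_cap_limg -(@limg_dim_eq _ _ _ i) ?ii ?capv0 //.
by rewrite lpreimK ?capvSr.
Qed.

End Flags.

                                         

(** * The category of triples of flags: morphism spaces, isomorphisms, sums, subobjects *)

Section Objects.

Variables (K : fieldType) (p q r : nat).
Local Notation obj := (obj K p q r).
Implicit Types X Y Z R S : obj.

Definition hom_space X Y : {vspace 'Hom(X, Y)} :=
  (homs (flagA X) (flagA Y) :&: homs (flagB X) (flagB Y)
   :&: homs (flagC X) (flagC Y))%VS.

Lemma homP X Y (f : 'Hom(X, Y)) :
  reflect [/\ preserves f (flagA X) (flagA Y), preserves f (flagB X) (flagB Y)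
            & preserves f (flagC X) (flagC Y)] (f \in hom_space X Y).
Proof.
rewrite !memv_cap -andbA.
by apply: (iffP and3P) => -[/memv_homs ? /memv_homs ? /memv_homs ?].
Qed.

Lemma memv_hom X Y (f : 'Hom(X, Y)) : f \in hom_space X Y <-> is_morphism f.
Proof.
split=> [/homP[fA fB fC]|[/preservesP fA /preservesP fB /preservesP fC]].
  by split; apply/preservesP.
by apply/homP.
Qed.

Lemma hom_id X : \1%VF \in hom_space X X.
Proof. by apply/homP; split=> i u uX; rewrite id_lfunE. Qed.

Lemma hom_comp X Y Z (g : 'Hom(Y, Z)) (f : 'Hom(X, Y)) :
  g \in hom_space Y Z -> f \in hom_space X Y -> (g \o f)%VF \in hom_space X Z.
Proof.
move=> /homP[gA gB gC] /homP[fA fB fC].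
by apply/homP; split=> i u uX; rewrite comp_lfunE; auto.
Qed.

Lemma isoI X Y (f : 'Hom(X, Y)) (g : 'Hom(Y, X)) :
  f \in hom_space X Y -> g \in hom_space Y X -> cancel f g -> cancel g f ->
    iso X Y.
Proof.
move=> /memv_hom fh /memv_hom gh fK gK; exists f, g; split=> //.
by split; apply/lfunP => x; rewrite comp_lfunE id_lfunE.
Qed.

Lemma isoP X Y : iso X Y <-> exists (f : 'Hom(X, Y)) (g : 'Hom(Y, X)),
  [/\ f \in hom_space X Y, g \in hom_space Y X, cancel f g & cancel g f].
Proof.
split=> [[f [g [/memv_hom fh /memv_hom gh [gf fg]]]]|[f [g []]]]; last first.
  exact: isoI.
by exists f, g; split=> // x; rewrite -comp_lfunE ?gf ?fg id_lfunE.
Qed.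

Lemma iso_refl X : iso X X.
Proof.
by apply: (@isoI _ _ \1%VF \1%VF); rewrite ?hom_id // => x; rewrite !id_lfunE.
Qed.

Lemma iso_sym X Y : iso X Y -> iso Y X.
Proof. by move=> /isoP[f [g [fh gh fK gK]]]; apply: (isoI gh fh). Qed.

Lemma iso_trans Y X Z : iso X Y -> iso Y Z -> iso X Z.
Proof.
move=> /isoP[f [g [fh gh fK gK]]] /isoP[f' [g' [fh' gh' fK' gK']]].
apply: (isoI (hom_comp fh' fh) (hom_comp gh gh')) => x; rewrite !comp_lfunE.
  by rewrite fK' fK.
by rewrite gK gK'.
Qed.

Lemma hom_fst X Y : pfst X Y \in hom_space (sum_obj X Y) X.
Proof. by apply/homP; split=> i u; rewrite memv_flag_sum pfstE => /andP[]. Qed.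

Lemma hom_snd X Y : psnd X Y \in hom_space (sum_obj X Y) Y.
Proof. by apply/homP; split=> i u; rewrite memv_flag_sum psndE => /andP[]. Qed.

Lemma hom_pair X Y Z (f : 'Hom(Z, X)) (g : 'Hom(Z, Y)) :
  f \in hom_space Z X -> g \in hom_space Z Y ->
    ppair f g \in hom_space Z (sum_obj X Y).
Proof.
move=> /homP[fA fB fC] /homP[gA gB gC]; apply/homP.
by split=> i u uZ; rewrite memv_flag_sum ppairE /=; apply/andP; auto.
Qed.

Definition pinl X Y : 'Hom(X, sum_obj X Y) := ppair \1%VF 0.
Definition pinr X Y : 'Hom(Y, sum_obj X Y) := ppair 0 \1%VF.

Lemma hom_inl X Y : pinl X Y \in hom_space X (sum_obj X Y).
Proof. by apply: hom_pair; rewrite ?hom_id ?mem0v. Qed.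

Lemma hom_inr X Y : pinr X Y \in hom_space Y (sum_obj X Y).
Proof. by apply: hom_pair; rewrite ?hom_id ?mem0v. Qed.

Lemma pinlE X Y x : pinl X Y x = (x, 0).
Proof. by rewrite ppairE id_lfunE zero_lfunE. Qed.

Lemma pinrE X Y y : pinr X Y y = (0, y).
Proof. by rewrite ppairE id_lfunE zero_lfunE. Qed.

Lemma iso_sum X X' Y Y' :
  iso X X' -> iso Y Y' -> iso (sum_obj X Y) (sum_obj X' Y').
Proof.
move=> /isoP[f [g [fh gh fK gK]]] /isoP[f' [g' [fh' gh' fK' gK']]].
apply: (@isoI (sum_obj X Y) (sum_obj X' Y') (ppair (f \o pfst X Y)
  (f' \o psnd X Y))
                  (ppair (g \o pfst X' Y') (g' \o psnd X' Y'))).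
- by rewrite hom_pair ?hom_comp ?hom_fst ?hom_snd.
- by rewrite hom_pair ?hom_comp ?hom_fst ?hom_snd.
- by case=> x y; rewrite !(ppairE, comp_lfunE, pfstE, psndE) /= fK fK'.
- by case=> x y; rewrite !(ppairE, comp_lfunE, pfstE, psndE) /= gK gK'.
Qed.

Lemma iso_sumC X Y : iso (sum_obj X Y) (sum_obj Y X).
Proof.
apply: (@isoI (sum_obj X Y) (sum_obj Y X) (ppair (psnd X Y) (pfst X Y))
  (ppair (psnd Y X) (pfst Y X))).
- by rewrite hom_pair ?hom_fst ?hom_snd.
- by rewrite hom_pair ?hom_fst ?hom_snd.
- by case=> x y; rewrite !(ppairE, pfstE, psndE).
- by case=> x y; rewrite !(ppairE, pfstE, psndE).
Qed.

Lemma iso_sumA X Y Z :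
  iso (sum_obj X (sum_obj Y Z)) (sum_obj (sum_obj X Y) Z).
Proof.
pose f := ppair (ppair (pfst X (sum_obj Y Z))
  (pfst Y Z \o psnd X (sum_obj Y Z)))
  (psnd Y Z \o psnd X (sum_obj Y Z)).
pose g := ppair (pfst X Y \o pfst (sum_obj X Y) Z)
  (ppair (psnd X Y \o pfst (sum_obj X Y) Z) (psnd (sum_obj X Y) Z)).
apply: (@isoI (sum_obj X (sum_obj Y Z)) (sum_obj (sum_obj X Y) Z) f g).
- apply: (hom_pair (hom_pair (hom_fst _ _) _) _).
    exact: (hom_comp (hom_fst _ _) (hom_snd _ _)).
  exact: (hom_comp (hom_snd _ _) (hom_snd _ _)).
- apply: (hom_pair _ (hom_pair _ (hom_snd _ _))).
    exact: (hom_comp (hom_fst _ _) (hom_fst _ _)).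
  exact: (hom_comp (hom_snd _ _) (hom_fst _ _)).
- by case=> x [y z]; rewrite !(ppairE, comp_lfunE, pfstE, psndE).
- by case=> [[x y] z]; rewrite !(ppairE, comp_lfunE, pfstE, psndE).
Qed.

Lemma iso_sumCA X Y Z :
  iso (sum_obj X (sum_obj Y Z)) (sum_obj Y (sum_obj X Z)).
Proof.
apply: iso_trans (iso_sumA _ _ _) _.
apply: iso_trans (iso_sum (iso_sumC _ _) (iso_refl _)) _.
exact: iso_sym (iso_sumA _ _ _).
Qed.

Lemma iso_dim X Y : iso X Y ->
  [/\ forall i, \dim (flagA X i) = \dim (flagA Y i),
      forall i, \dim (flagB X i) = \dim (flagB Y i)
    & forall i, \dim (flagC X i) = \dim (flagC Y i)].
Proof.
have le n (V W : vectType K) (A : flag V n) (B : flag W n)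
    (f : 'Hom(V, W)) (g : 'Hom(W, V)) :
    preserves f A B -> cancel f g -> forall i, (\dim (A i) <= \dim (B i))%N.
  move=> /preservesP fAB fK i; rewrite -(@limg_dim_eq _ _ _ f) ?dimvS //.
  by have /lker0P/eqP-> := can_inj fK; rewrite capv0.
move=> /isoP[f [g [/homP[fA fB fC] /homP[gA gB gC] fK gK]]].
by split=> i; apply/eqP; rewrite eqn_leq;
  apply/andP; split; [exact: (le _ _ _ _ _ f g) | exact: (le _ _ _ _ _ g f)
    | exact: (le _ _ _ _ _ f g) | exact: (le _ _ _ _ _ g f)
    | exact: (le _ _ _ _ _ f g) | exact: (le _ _ _ _ _ g f)].
Qed.

Lemma iso_dim_carrier X Y : iso X Y -> \dim {:X} = \dim {:Y}.
Proof. by case/iso_dim => /(_ ord_max); rewrite !flag_ord_max. Qed.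

Lemma eq_dimvecP X Y : dimvec X = dimvec Y <->
  [/\ forall i, \dim (flagA X i) = \dim (flagA Y i),
      forall i, \dim (flagB X i) = \dim (flagB Y i)
    & forall i, \dim (flagC X i) = \dim (flagC Y i)].
Proof.
split=> [e|[eA eB eC]]; last by congr (_, _, _); apply: eq_flag_type.
have eA := congr1 (fun d => d.1.1) e; have eB := congr1 (fun d => d.1.2) e.
by have eC := congr1 (fun d => d.2) e; split; apply: flag_type_dim.
Qed.

Lemma iso_dimvec X Y : iso X Y -> dimvec X = dimvec Y.
Proof. by move=> /iso_dim/eq_dimvecP. Qed.

Lemma dimvec_dim X Y : dimvec X = dimvec Y -> \dim {:X} = \dim {:Y}.
Proof.
by move=> /eq_dimvecP[/(_ ord_max) + _ _]; rewrite !flag_ord_max.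
Qed.

(** An injective linear map need not have a flag-preserving inverse; here equality of the dimensions
    of all members forces each member to be mapped onto its counterpart. *)
Lemma hom_inv X Y (f : 'Hom(X, Y)) : dimvec X = dimvec Y ->
  f \in hom_space X Y -> lker f == 0%VS ->
  [/\ f^-1%VF \in hom_space Y X, cancel f f^-1%VF & cancel f^-1%VF f].
Proof.
move=> /eq_dimvecP[dA dB dC].
move=> /homP[fA fB fC] f0.
have img n (A : flag X n) (B : flag Y n) :
  (forall i, \dim (A i) = \dim (B i)) ->
    preserves f A B -> forall i, (f @: A i)%VS = B i.
  move=> dAB /preservesP fAB i; apply/eqP; rewrite eqEdim fAB /=.
  by rewrite limg_dim_eq ?dAB // (eqP f0) capv0.
have fs : limg f = fullv.
  by have := img _ _ _ dA fA ord_max; rewrite !flag_ord_max.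
have inv n (A : flag X n) (B : flag Y n) :
  (forall i, \dim (A i) = \dim (B i)) ->
    preserves f A B -> preserves f^-1%VF B A.
  move=> dAB fAB i u; rewrite -(img _ _ _ dAB fAB) => /memv_imgP[v vA ->].
  by rewrite lker0_lfunK.
split; first by apply/homP; split; apply: inv.
  exact: lker0_lfunK.
by move=> y; rewrite limg_lfunVK // fs memvf.
Qed.

Lemma iso_inj X Y (f : 'Hom(X, Y)) : dimvec X = dimvec Y ->
  f \in hom_space X Y -> lker f == 0%VS -> iso X Y.
Proof. by move=> dXY fh f0; have [gh fK gK] := hom_inv dXY fh f0;
  apply: isoI gK. Qed.

Lemma iso_zeroP X : iso X (zero_obj K p q r) <-> \dim {:X} = 0%N.
Proof.
split=> [/iso_dim_carrier->|/eqP X0]; first by rewrite dimvf /= /dim /= mul1n.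
move: X0; rewrite dimv_eq0 => /eqP X0.
have z x : x = 0 :> X by apply/eqP; rewrite -memv0 -X0 memvf.
apply: (@isoI _ _ 0 0); rewrite ?mem0v // => x.
  by rewrite zero_lfunE [RHS]z.
by rewrite [LHS]thinmx0 [RHS]thinmx0.
Qed.

Lemma iso_sum0 X Z : iso Z (zero_obj K p q r) -> iso (sum_obj X Z) X.
Proof.
move=> /iso_zeroP/eqP; rewrite dimv_eq0 => /eqP Z0.
have z x : x = 0 :> Z by apply/eqP; rewrite -memv0 -Z0 memvf.
apply: (@isoI (sum_obj X Z) X (pfst X Z) (pinl X Z));
  rewrite ?hom_fst ?hom_inl //.
  by case=> x y; rewrite pfstE pinlE [y]z.
by move=> x; rewrite pinlE pfstE.
Qed.

Lemma dim_sum_obj X Y : \dim {:sum_obj X Y} = (\dim {:X} + \dim {:Y})%N.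
Proof. by rewrite !dimvf. Qed.

Lemma lker_vsval (V : vectType K) (N : {vspace V}) :
  lker (linfun (vsval : subvs_of N -> V)) = 0%VS.
Proof. by apply/eqP/lker0P => x y; rewrite !lfunE; apply: subvs_inj. Qed.

Definition sub_obj X (N : {vspace X}) : obj :=
  Obj (flag_pull (flagA X) (lker_vsval N)) (flag_pull (flagB X) (lker_vsval N))
      (flag_pull (flagC X) (lker_vsval N)).

Definition sub_incl X (N : {vspace X}) : 'Hom(sub_obj N, X) :=
  linfun (vsval : subvs_of N -> X).

Lemma sub_inclE X (N : {vspace X}) u : sub_incl N u = vsval u.
Proof. exact: lfunE. Qed.

Lemma hom_sub_incl X (N : {vspace X}) : sub_incl N \in hom_space (sub_obj N) X.
Proof. by apply/homP; split=> i u; rewrite memv_flag_pull. Qed.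

Definition sub_corestr X Y (N : {vspace X}) (f : 'Hom(Y, X)) :
  'Hom(Y, sub_obj N) := (linfun (vsproj N) \o f)%VF.

Lemma sub_corestrK X Y (N : {vspace X}) (f : 'Hom(Y, X)) y :
  f y \in N -> vsval (sub_corestr N f y) = f y.
Proof. by move=> fN; rewrite comp_lfunE lfunE /= vsprojK. Qed.

Lemma hom_sub_corestr X Y (N : {vspace X}) (f : 'Hom(Y, X)) :
  f \in hom_space Y X -> (forall y, f y \in N) ->
    sub_corestr N f \in hom_space Y (sub_obj N).
Proof.
move=> /homP[fA fB fC] fN; apply/homP.
by split=> i u uY; rewrite memv_flag_pull lfunE /= sub_corestrK; auto.
Qed.

(** The complement is the kernel of [s] with the induced flags. The idempotent 1 - is respects the
    flags, so the splitting holds on every member. *)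
Lemma split_summand X R (i : 'Hom(R, X)) (s : 'Hom(X, R)) :
  i \in hom_space R X -> s \in hom_space X R -> cancel i s ->
  exists S, iso X (sum_obj R S).
Proof.
move=> ih sh iK; pose N := lker s; exists (sub_obj N).
have tN x : (\1 - (i \o s))%VF x \in N.
  rewrite memv_ker !(add_lfunE, opp_lfunE, comp_lfunE, id_lfunE) linearB /=.
  by rewrite iK subrr.
have th : (\1 - (i \o s))%VF \in hom_space X X by rewrite memvB ?hom_id
  ?hom_comp.
pose g := ((i \o pfst R (sub_obj N)) + (sub_incl N \o psnd R (sub_obj N)))%VF.
apply: (@isoI X (sum_obj R (sub_obj N))
  (ppair s (sub_corestr N (\1 - (i \o s))%VF)) g).
- by rewrite hom_pair ?hom_sub_corestr.
- by rewrite memvD ?hom_comp ?hom_fst ?hom_snd ?hom_sub_incl.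
- move=> x; rewrite add_lfunE !comp_lfunE ppairE pfstE psndE sub_inclE /=.
  rewrite sub_corestrK // !(add_lfunE, opp_lfunE, comp_lfunE, id_lfunE).
  by rewrite addrC subrK.
case=> x y; have : s (vsval y) = 0 by apply/eqP; rewrite -memv_ker subvsP.
rewrite add_lfunE !comp_lfunE ppairE pfstE psndE sub_inclE /= => sy.
congr (_, _); first by rewrite linearD /= iK sy addr0.
apply: subvs_inj; rewrite sub_corestrK //.
rewrite !(add_lfunE, opp_lfunE, comp_lfunE, id_lfunE) !linearD /= iK sy.
by rewrite linear0 subr0 addrC addKr.
Qed.

End Objects.

                                     

(** * The Krull-Schmidt theorem: Fitting's lemma, cancellation, exchange *)

Lemma minimizer (T : Type) (P : T -> Prop) (F : T -> nat) x0 : P x0 ->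
  exists2 x, P x & forall y, P y -> (F x <= F y)%N.
Proof.
elim: (F x0) {-2}x0 (leqnn (F x0)) => {x0} [|n IHn] x.
  by rewrite leqn0 => /eqP x0 Px; exists x => // y _; rewrite x0.
move=> xn Px; have [[y Py yx]|] := classic (exists2 y, P y & (F y < F x)%N).
  by apply: (IHn y) => //; rewrite -ltnS (leq_trans yx).
by move=> no; exists x => // y Py; rewrite leqNgt; apply/negP => yx; case: no;
  exists y.
Qed.

Section KrullSchmidt.

Variables (K : fieldType) (p q r : nat).
Local Notation obj := (obj K p q r).
Local Notation zero := (zero_obj K p q r).
Implicit Types X Y Z R S : obj.

(** Locality of the endomorphism ring, in the form that is used: every endomorphism is invertible or
    nilpotent. *)
Definition local_end Z := forall f : 'End(Z), f \in hom_space Z Z ->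
  lker f == 0%VS \/ exists k, forall z, iter k f z = 0.

Lemma lker0_1Bnil (V : vectType K) (f : 'End(V)) k :
  (forall z, iter k f z = 0) -> lker (\1 - f)%VF == 0%VS.
Proof.
move=> fk; rewrite -subv0; apply/subvP => x.
rewrite memv_ker add_lfunE opp_lfunE id_lfunE subr_eq0 => /eqP xf.
rewrite memv0 -(fk x); elim: k {fk} => //= k /eqP <-; exact/eqP.
Qed.

Lemma lker0_compl (V : vectType K) (f g : 'End(V)) :
  lker (f \o g)%VF == 0%VS -> lker f == 0%VS.
Proof.
move=> fg0; have gf : cancel (g \o (f \o g)^-1)%VF f.
  by move=> x; rewrite comp_lfunE -[f (g _)]comp_lfunE lker0_lfunVK.
have /lker0P/lker0_lfunVK h := can_inj gf.
apply/lker0P => x y; rewrite -[x]h -[y]h !gf.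
by move=> ->.
Qed.

Lemma local_end_split Z (f g : 'End(Z)) : local_end Z ->
  f \in hom_space Z Z -> g \in hom_space Z Z -> (f + g = \1)%VF ->
  lker f == 0%VS \/ lker g == 0%VS.
Proof.
move=> lZ fh gh fg; have [?|[k gk]] := lZ _ gh; first by right.
by left; rewrite -[f](addrK g) fg; apply: lker0_1Bnil gk.
Qed.

(** Fitting's lemma. A power g of f of least rank restricts to an automorphism of its image R, so R
    is a direct summand. Either R = 0 and f is nilpotent, or R is everything and f is injective. *)
Lemma indecomposable_local Z : indecomposable Z -> local_end Z.
Proof.
move=> [Z0 Zind] f fh.
pose pw k := iter k (fun h => f \o h)%VF \1%VF.
have pwE k z : pw k z = iter k f z.
  by elim: k => [|k IHk]; rewrite /= ?id_lfunE // comp_lfunE IHk.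
have pwh k : pw k \in hom_space Z Z.
  by elim: k => [|k IHk]; rewrite /= ?hom_id // hom_comp.
(* Exponents are shifted by one so that [g] is a positive power of f, whose injectivity gives that
   of f. *)
have [k _ kmin] := @minimizer nat xpredT (fun k =>
  \dim (limg (pw k.+1))) 0%N isT.
pose g := pw k.+1.
have gg : (g @: limg g)%VS = limg g.
  apply/eqP; rewrite eqEdim limgS ?subvf //=.
  suff <- : limg (pw (k + k.+1).+1) = (g @: limg g)%VS by exact: kmin.
  rewrite -limg_comp; congr (_ @: _)%VS; apply/lfunP => z.
  by rewrite [RHS]comp_lfunE !pwE -iterD addSn.
pose R := sub_obj (limg g).
have dR : \dim {:R} = \dim (limg g) by rewrite dimvf.
pose c := sub_corestr (limg g) g.
have gR y : g y \in limg g by rewrite memv_img ?memvf.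
have ch : c \in hom_space Z R by rewrite hom_sub_corestr ?pwh.
pose h : 'End(R) := (c \o sub_incl (limg g))%VF.
have hh : h \in hom_space R R by rewrite hom_comp ?hom_sub_incl.
have h0 : lker h == 0%VS.
  rewrite -subv0; apply/subvP => y; rewrite memv_ker comp_lfunE =>
    /eqP/congr_subvs.
  rewrite sub_corestrK // sub_inclE => gy; rewrite memv0; apply/eqP/subvs_inj.
  have : vsval y \in (limg g :&: lker g)%VS by rewrite memv_cap subvsP memv_ker
    gy eqxx.
  suff -> : (limg g :&: lker g)%VS = 0%VS by rewrite memv0 => /eqP.
  apply/eqP; rewrite -dimv_eq0 -(eqn_add2r (\dim (g @: limg g))) limg_ker_dim.
  by rewrite gg.
have [hVh hK hVK] := hom_inv erefl hh h0.
have [|S ZRS] := @split_summand _ _ _ _ Z R (sub_incl (limg g)) (h^-1 \o c)%VF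
  (hom_sub_incl _) (hom_comp hVh ch).
  by move=> y; rewrite comp_lfunE -[c _]comp_lfunE hK.
have [/iso_zeroP R0|/iso_zeroP S0] := Zind _ _ ZRS.
  right; exists k.+1 => z; rewrite -pwE; apply/eqP; rewrite -memv0.
  suff <- : limg g = 0%VS by [].
  by apply/eqP; rewrite -dimv_eq0 -dR R0.
left; have := iso_dim_carrier ZRS; rewrite dim_sum_obj S0 addn0 => ZR.
have g0 : lker g == 0%VS.
  rewrite -dimv_eq0 -(eqn_add2r (\dim (limg g))) dim_lker_limg ZR.
  by rewrite dR.
apply/lker0P => x y fxy; apply: (lker0P g0).
by rewrite !pwE !iterSr fxy.
Qed.

(** Block elimination. When the Z-to-Z block d of the isomorphism is invertible, with c its X-to-Z
    block, the graph of -d^-1 c is a copy of X that f carries onto X'. *)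
Lemma cancel_bij X X' Z (f : 'Hom(sum_obj X Z, sum_obj X' Z))
    (g : 'Hom(sum_obj X' Z, sum_obj X Z)) :
  f \in hom_space (sum_obj X Z) (sum_obj X' Z) ->
  g \in hom_space (sum_obj X' Z) (sum_obj X Z) -> cancel f g -> cancel g f ->
  lker (psnd X' Z \o f \o pinr X Z)%VF == 0%VS -> iso X X'.
Proof.
move=> fh gh fK gK; set d := (_ \o pinr X Z)%VF => d0.
have dh : d \in hom_space Z Z.
  exact: (hom_comp (hom_comp (hom_snd _ _) fh) (hom_inr _ _)).
have [dVh dK dVK] := hom_inv erefl dh d0.
pose c := (psnd X' Z \o f \o pinl X Z)%VF.
have ch : c \in hom_space X Z.
  exact: (hom_comp (hom_comp (hom_snd _ _) fh) (hom_inl _ _)).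
pose l : 'Hom(X, sum_obj X Z) := ppair \1%VF (- (d^-1 \o c))%VF.
have lh : l \in hom_space X (sum_obj X Z).
  by apply: hom_pair; rewrite ?hom_id // memvN hom_comp.
have fE x z : psnd X' Z (f (x, z)) = c x + d z.
  rewrite -[(x, z)]/((x, z) : sum_obj X Z).
  have -> : (x, z) = pinl X Z x + pinr X Z z :> sum_obj X Z.
    by rewrite pinlE pinrE /=; congr (_, _); rewrite ?addr0 ?add0r.
  by rewrite !linearD /= !comp_lfunE.
have lE x : l x = (x, - d^-1%VF (c x)).
  by rewrite ppairE id_lfunE opp_lfunE comp_lfunE.
have fl x : f (l x) = (pfst X' Z (f (l x)), 0).
  rewrite pfstE [LHS]surjective_pairing; congr (_, _).
  by rewrite -psndE lE fE linearN /= dVK subrr.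
apply: (@isoI _ _ _ _ X X' (pfst X' Z \o f \o l)%VF (pfst X Z \o g \o pinl X'
  Z)%VF).
- exact: (hom_comp (hom_comp (hom_fst _ _) fh) lh).
- exact: (hom_comp (hom_comp (hom_fst _ _) gh) (hom_inl _ _)).
- move=> x; rewrite !comp_lfunE pinlE -fl fK pfstE lE //.
move=> x; rewrite !comp_lfunE.
have [y [z E]] : exists y z, g (pinl X' Z x) = (y, z).
  by exists (g (pinl X' Z x)).1, (g (pinl X' Z x)).2; apply: surjective_pairing.
have := gK (pinl X' Z x); rewrite E => fyz.
have zE : z = - d^-1%VF (c y).
  rewrite -linearN -[z]dK; congr (_ _); apply/eqP.
  by rewrite -addr_eq0 addrC -fE fyz psndE pinlE.
by rewrite [X in pfst _ _ (f (l X))]pfstE lE -zE fyz pfstE pinlE.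
Qed.

                                                                               
                                                                      
(** If the block [d] of f is singular, composing f with a shear of the source makes it invertible;
    locality of End(Z) supplies this, and [cancel_bij] applies. *)
Lemma cancel_local X X' Z :
  local_end Z -> iso (sum_obj X Z) (sum_obj X' Z) -> iso X X'.
Proof.
move=> lZ /isoP[f [g [fh gh fK gK]]].
pose d := (psnd X' Z \o f \o pinr X Z)%VF.
have dh : d \in hom_space Z Z.
  exact: (hom_comp (hom_comp (hom_snd _ _) fh) (hom_inr _ _)).
case: (boolP (lker d == 0%VS)) => [|d0]; first exact: cancel_bij fh gh fK gK.
pose b := (pfst X Z \o g \o pinr X' Z)%VF.
pose d' := (psnd X Z \o g \o pinr X' Z)%VF.
have bh : b \in hom_space Z X.
  exact: (hom_comp (hom_comp (hom_fst _ _) gh) (hom_inr _ _)).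
have d'h : d' \in hom_space Z Z.
  exact: (hom_comp (hom_comp (hom_snd _ _) gh) (hom_inr _ _)).
pose s (e : 'Hom(Z, X)) : 'End(sum_obj X Z) :=
  ppair (pfst X Z + (e \o psnd X Z))%VF (psnd X Z).
have sh e : e \in hom_space Z X -> s e \in hom_space (sum_obj X Z)
  (sum_obj X Z).
  move=> eh; apply: hom_pair (hom_snd _ _); apply: memvD; first exact: hom_fst.
  exact: (hom_comp eh (hom_snd _ _)).
have sE e x : s e x = (x.1 + e x.2, x.2).
  by rewrite ppairE add_lfunE comp_lfunE pfstE psndE.
have sK e : cancel (s e) (s (- e)).
  by case=> x z; rewrite !sE opp_lfunE /= addrK.
have sNK e : cancel (s (- e)) (s e).
  by case=> x z; rewrite !sE opp_lfunE /= subrK.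
apply: (@cancel_bij X X' Z (f \o s b)%VF (s (- b) \o g)%VF).
- by rewrite (hom_comp fh) ?sh.
- by rewrite hom_comp ?sh ?memvN.
- by move=> x; rewrite !comp_lfunE fK sK.
- by move=> x; rewrite !comp_lfunE sNK gK.
(* The new block is c b + d, and fg = 1 gives c b + d d' = 1. As d is singular, so is d(d' - 1),
   hence it is nilpotent and the block is invertible. *)
have -> : (psnd X' Z \o (f \o s b) \o pinr X Z = \1 - (d \o (d' - \1)))%VF.
  apply/lfunP => z; rewrite !(comp_lfunE, add_lfunE, opp_lfunE, id_lfunE) pinrE.
  rewrite sE /= add0r.
  have bd : g (0, z) = (b z, d' z).
    by rewrite !comp_lfunE pfstE psndE pinrE -surjective_pairing.
  have fbd : psnd X' Z (f (b z, d' z)) = z by rewrite -bd gK psndE.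
  have <- : (b z, d' z) - pinr X Z (d' z - z) = (b z, z) :> sum_obj X Z.
    rewrite pinrE; congr (_, _); rewrite /= ?subr0 //.
    by rewrite opprB addrCA subrr addr0.
  rewrite [f _]linearB linearB /= fbd; congr (_ - psnd _ _ (f _)).
  by rewrite !comp_lfunE.
have [k dk] : exists k, forall z, iter k (d \o (d' - \1))%VF z = 0.
  case: (lZ (d \o (d' - \1))%VF).
  - by rewrite hom_comp ?memvB ?hom_id.
  - by move=> /lker0_compl; rewrite (negPf d0).
  - by [].
exact: lker0_1Bnil dk.
Qed.

Lemma direct_sum_cat (s t : seq obj) :
  iso (direct_sum (s ++ t)) (sum_obj (direct_sum s) (direct_sum t)).
Proof.
elim: s => [|X s IHs] /=.
  apply: iso_sym; apply: iso_trans (iso_sumC _ _) _.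
  exact/iso_sum0/iso_refl.
exact: iso_trans (iso_sum (iso_refl _) IHs) (iso_sumA _ _ _).
Qed.

Lemma krull_schmidt_exists X : exists s : seq obj,
  List.Forall (@indecomposable K p q r) s /\ iso X (direct_sum s).
Proof.
have [n] := ubnP (\dim {:X}); elim: n X => // n IHn X; rewrite ltnS => Xn.
have [X0|X0] := classic (iso X zero); first by exists [::].
have [Xi|Xi] := classic (indecomposable X).
  exists [:: X]; split; first by constructor.
  exact/iso_sym/iso_sum0/iso_refl.
have [Y [Z [XYZ Y0 Z0]]] : exists Y Z,
    [/\ iso X (sum_obj Y Z), ~ iso Y zero & ~ iso Z zero].
  apply: NNPP => no; apply: Xi; split=> // Y Z XYZ; apply: NNPP => YZ.
  by apply: no; exists Y, Z; split=> // h; apply: YZ; [left|right].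
have dXYZ := iso_dim_carrier XYZ; rewrite dim_sum_obj in dXYZ.
have gt0 W : ~ iso W zero -> (0 < \dim {:W})%N.
  by move=> W0; rewrite lt0n; apply/eqP => /iso_zeroP.
have [|s [si Ys]] := IHn Y.
  by rewrite (leq_trans _ Xn) // dXYZ -addn1 leq_add2l gt0.
have [|t [ti Zt]] := IHn Z.
  by rewrite (leq_trans _ Xn) // dXYZ -add1n leq_add2r gt0.
exists (s ++ t); split; first by apply/List.Forall_app.
apply: iso_trans XYZ _; apply: iso_trans (iso_sum Ys Zt) _.
exact/iso_sym/direct_sum_cat.
Qed.

(** Any Z can be cancelled by removing its indecomposable summands one at a time. *)
Lemma sum_cancel X X' Z : iso (sum_obj X Z) (sum_obj X' Z) -> iso X X'.
Proof.
have [s [si Zs]] := krull_schmidt_exists Z.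
move=> XX'; have {Zs XX'} : iso (sum_obj X (direct_sum s))
  (sum_obj X' (direct_sum s)).
  apply: iso_trans (iso_sum (iso_refl _) (iso_sym Zs)) _.
  exact: iso_trans XX' (iso_sum (iso_refl _) Zs).
elim: s si => [_ /=|Y s IHs].
  by move=> h; apply: iso_trans (iso_sym (iso_sum0 _ (iso_refl _)))
                      (iso_trans h (iso_sum0 _ (iso_refl _))).
move=> /List.Forall_cons_iff[Yi si] /= h; apply: IHs => //.
apply: (cancel_local (indecomposable_local Yi)).
apply: iso_trans (iso_sym (iso_sumA _ _ _)) _.
apply: iso_trans (iso_sum (iso_refl _) (iso_sumC _ _)) _.
apply: iso_trans h _; apply: iso_trans (iso_sumA _ _ _).
exact: iso_sum (iso_refl _) (iso_sumC _ _).
Qed.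

(** Exchange property: the identity of Z is a sum of endomorphisms factoring through the members of
    [s], and by locality one of them is invertible. *)
Lemma local_summand Z (s : seq obj) (i : 'Hom(Z, direct_sum s))
    (t : 'Hom(direct_sum s, Z)) : indecomposable Z ->
  i \in hom_space Z (direct_sum s) -> t \in hom_space (direct_sum s) Z ->
  cancel i t ->
  exists Y (a : 'Hom(Z, Y)) (b : 'Hom(Y, Z)), [/\ List.In Y s,
    a \in hom_space Z Y, b \in hom_space Y Z & lker (b \o a)%VF == 0%VS].
Proof.
move=> Zi; have lZ := indecomposable_local Zi.
elim: s i t => [|Y s IHs] /= i t ih th iK.
  case: Zi => Z0 _; case: Z0; apply/iso_zeroP; apply/eqP;
    rewrite dimv_eq0 -subv0.
  apply/subvP => z _; rewrite memv0 -[z]iK [i z]thinmx0 linear0; exact/eqP.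
pose S := direct_sum s.
pose a := (pfst Y S \o i)%VF; pose b := (t \o pinl Y S)%VF.
have ah : a \in hom_space Z Y by exact: (hom_comp (hom_fst _ _) ih).
have bh : b \in hom_space Y Z by exact: (@hom_comp _ _ _ _ Y (sum_obj Y S)
  Z t (pinl Y S) th (hom_inl Y S)).
pose c := (psnd Y S \o i)%VF; pose d := (t \o pinr Y S)%VF.
have ch : c \in hom_space Z S by exact: (hom_comp (hom_snd _ _) ih).
have dh : d \in hom_space S Z by exact: (@hom_comp _ _ _ _ S (sum_obj Y S)
  Z t (pinr Y S) th (hom_inr Y S)).
have abcd : ((b \o a) + (d \o c) = \1)%VF.
  apply/lfunP => z; rewrite add_lfunE !comp_lfunE id_lfunE -linearD -[RHS]iK.
  congr (t _); rewrite pinlE pinrE pfstE psndE [RHS]surjective_pairing.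
  by congr (_, _); rewrite /= ?addr0 ?add0r.
have [ba|dc] := local_end_split lZ (hom_comp bh ah) (hom_comp dh ch) abcd.
  by exists Y, a, b; split=> //; left.
have [dcVh dcK _] := hom_inv erefl (hom_comp dh ch) dc.
have [|W [a' [b' [Ws a'h b'h ba']]]] :=
  IHs c ((d \o c)^-1 \o d)%VF ch (hom_comp dcVh dh).
  by move=> z; rewrite comp_lfunE -[d (c z)]comp_lfunE dcK.
by exists W, a', b'; split=> //; right.
Qed.

Lemma indecomposable_split Y Z (a : 'Hom(Z, Y)) (b : 'Hom(Y, Z)) :
  indecomposable Y -> ~ iso Z zero ->
  a \in hom_space Z Y -> b \in hom_space Y Z -> lker (b \o a)%VF == 0%VS ->
  iso Z Y.
Proof.
move=> [_ Yi] Z0 ah bh ba0.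
have [baVh baK _] := hom_inv erefl (hom_comp bh ah) ba0.
have [|S YZS] := @split_summand _ _ _ _ Y Z a ((b \o a)^-1 \o b)%VF ah (hom_comp
  baVh bh).
  by move=> z; rewrite comp_lfunE -[b (a z)]comp_lfunE baK.
by case: (Yi _ _ YZS) => [//|S0]; apply: iso_sym (iso_trans YZS (iso_sum0 _
  S0)).
Qed.

Section Uniqueness.

Variables (T : eqType) (I : T -> obj) (P : T -> Prop).
Hypothesis Iindec : forall d, P d -> indecomposable (I d).
Hypothesis Iinj : forall d e, P d -> P e -> iso (I d) (I e) -> d = e.

Lemma direct_sum_rem d s : d \in s ->
  iso (direct_sum (map I s)) (sum_obj (I d) (direct_sum (map I (rem d s)))).
Proof.
elim: s => // e s IHs; rewrite inE /= eq_sym.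
have [-> _|_ /= ds] := eqVneq e d; first exact: iso_refl.
apply: iso_trans (iso_sum (iso_refl _) (IHs ds)) _.
exact: iso_sumCA.
Qed.

(** The first summand on the left splits off some summand on the right, so has the same label;
    cancel both and recurse. *)
Lemma krull_schmidt_unique s t :
  (forall e, e \in s -> P e) -> (forall e, e \in t -> P e) ->
  iso (direct_sum (map I s)) (direct_sum (map I t)) -> perm_eq s t.
Proof.
elim: s t => [|d s IHs] t sP tP st.
  case: t tP st => // d t tP /= h; case: (Iindec (tP d (mem_head _ _))) => I0 _;
    case: I0.
  have := iso_dim_carrier (iso_sym h); rewrite dim_sum_obj.
  have /iso_zeroP-> := iso_refl zero; move=> /eqP; rewrite addn_eq0.
  by case/andP => /eqP/iso_zeroP.
have Pd := sP d (mem_head _ _).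
have [f [g [fh gh fK gK]]] := (proj1 (isoP _ _)) st.
pose S := direct_sum (map I s).
have [|Y [a [b [Yt ah bh ba]]]] := @local_summand (I d) (map I t)
  (f \o pinl (I d) S)%VF (pfst (I d) S \o g)%VF (Iindec Pd)
  (hom_comp fh (hom_inl _ _)) (hom_comp (hom_fst _ _) gh).
  by move=> x; rewrite !comp_lfunE fK pinlE pfstE.
have [e et Ye] : exists2 e, e \in t & Y = I e.
  elim: t Yt {tP st f g fh gh fK gK} => //= e t IHt [<-|/IHt[e' e't ->]].
    by exists e; rewrite ?mem_head.
  by exists e'; rewrite // inE e't orbT.
have Pe := tP e et; rewrite Ye in a b ah bh ba.
have de := Iinj Pd Pe (indecomposable_split (Iindec Pe) (proj1 (Iindec Pd))
  ah bh ba).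
rewrite -{e Ye Pe}de in et a b ah bh ba.
rewrite perm_sym (permPl (perm_to_rem et)) perm_cons perm_sym.
apply: IHs => [e es|e /mem_rem et'|]; first by apply: sP; rewrite inE es orbT.
  exact: tP.
apply: (@sum_cancel _ _ (I d)).
apply: iso_trans (iso_sumC _ _) (iso_trans st _).
exact: iso_trans (direct_sum_rem et) (iso_sumC _ _).
Qed.

End Uniqueness.

End KrullSchmidt.

                                

(** * Bases adapted to a flag; conjugacy, sections and the dimension of a parabolic algebra *)

Section AdaptedBasis.

Variable K : fieldType.
Implicit Types V W : vectType K.

Definition adapted V p (A : flag V p) (b : seq V) :=
  basis_of {:V} b /\ forall i, A i = <<take (\dim (A i)) b>>%VS.

Lemma adapted_exists V p (A : flag V p) : exists b, adapted A b.
Proof.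
suff step n (np : (n < p.+1)%N) : exists2 b, basis_of (A (Ordinal np)) b &
    forall i : 'I_p.+1, (i <= n)%N -> A i = <<take (\dim (A i)) b>>%VS.
  have [b bA bi] := step p (ltnSn p).
  have pE : Ordinal (ltnSn p) = ord_max by exact/val_inj.
  exists b; split; first by rewrite -(flag_ord_max A) -pE.
  by move=> i; apply: bi; rewrite -ltnS.
elim: n np => [|n IHn] np.
  have A0 (i : 'I_p.+1) : (i <= 0)%N -> A i = 0%VS.
    by rewrite leqn0 => /eqP i0; rewrite -(flag_ord0 A); congr (A _);
      apply/val_inj.
  exists [::]; first by rewrite A0 ?nil_basis.
  by move=> i /A0->; rewrite dimv0 span_nil.
have [b bA bi] := IHn (ltnW np); set k := Ordinal np; set j := Ordinal _ in bA.
have jk : (A j <= A k)%VS by rewrite flag_mono.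
have szb : size b = \dim (A j) by rewrite (size_basis (X := in_tuple b) bA).
pose c := vbasis (A k :\: A j).
have bc : basis_of (A k) (b ++ c).
  have AjkE : ((A k :\: A j) + A j)%VS = A k by rewrite addv_diff;
    apply/addv_idPl.
  have dir : directv (A j + (A k :\: A j)).
    by apply/directv_addP; rewrite capvC capv_diff.
  by have := cat_basis dir bA (vbasisP _); rewrite addvC AjkE.
exists (b ++ c) => // i; rewrite leq_eqVlt => /predU1P[ik|].
  have -> : i = k by exact/val_inj.
  rewrite take_oversize ?(span_basis bc) //.
  by rewrite (size_basis (X := in_tuple (b ++ c)) bc).
rewrite ltnS => ij; rewrite takel_cat; first exact: bi.
by rewrite szb dimvS // flag_mono.
Qed.

Lemma size_adapted V p (A : flag V p) b : adapted A b -> size b = \dim {:V}.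
Proof. by case=> bV _; rewrite (size_basis (X := in_tuple b) bV). Qed.

Lemma lfun_basis V W (b : seq V) (c : seq W) : basis_of {:V} b ->
  size c = size b -> exists f : 'Hom(V, W), map f b = c.
Proof.
move=> bV cb; have [f fb] := linear_of_free b c.
exists (linfun f); rewrite -(fb (basis_free bV) cb).
by apply: eq_map => x; rewrite lfunE.
Qed.

Lemma flag_conj V W p (A : flag V p) (B : flag W p) :
  (forall i, \dim (A i) = \dim (B i)) ->
  exists2 h : 'Hom(V, W), lker h == 0%VS & forall i, (h @: A i)%VS = B i.
Proof.
move=> AB; have [b bA] := adapted_exists A; have [c cB] := adapted_exists B.
have VW : \dim {:V} = \dim {:W} by have := AB ord_max; rewrite !flag_ord_max.
have [|h hb] := lfun_basis (proj1 bA) (c := c).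
  by rewrite (size_adapted bA) (size_adapted cB).
have hAB i : (h @: A i)%VS = B i.
  by rewrite (proj2 bA) limg_span map_take hb AB -(proj2 cB).
exists h => //; rewrite -dimv_eq0 -(eqn_add2r (\dim (limg h))) dim_lker_limg.
by rewrite -(flag_ord_max A) hAB !flag_ord_max VW.
Qed.

(** A single flag always splits: lift each vector of a basis adapted to the image flag into the
    smallest member of A whose image contains it. Obstructions arise only from making three flags
    split at once. *)
Lemma flag_section V W p (A : flag V p) (g : 'Hom(V, W)) (gs : limg g = fullv) :
  exists2 s : 'Hom(W, V), cancel s g & preserves s (flag_push A gs) A.
Proof.
have [b bB] := adapted_exists (flag_push A gs).
pose lev (w : W) : 'I_p.+1 := [arg min_(i < ord_max | w \in (g @: A i)%VS) i].
have levP w : w \in (g @: A (lev w))%VS /\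
    forall i, w \in (g @: A i)%VS -> (lev w <= i)%N.
  rewrite /lev; case: arg_minnP => [|i wi imin]; last by [].
  by rewrite flag_ord_max gs memvf.
pose L w := projv (A (lev w)) ((g \o projv (A (lev w)))^-1%VF w).
have LK w : g (L w) = w.
  rewrite /L -[g _]comp_lfunE limg_lfunVK // limg_comp limg_proj.
  by have [] := levP w.
have [s sb] := lfun_basis (proj1 bB) (size_map L b).
have sL w : w \in b -> s w = L w.
  by move: w; apply/eq_in_map.
have gsK : (g \o s = \1)%VF.
  apply: (proj2 (fullv_lfunP _ _ (span_basis (proj1 bB)))) => w wb.
  by rewrite comp_lfunE sL // LK id_lfunE.
exists s; first by move=> w; rewrite -comp_lfunE gsK id_lfunE.
apply/preservesP => i; rewrite (proj2 bB) limg_span;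
  apply/span_subvP => _ /mapP[w wb ->].
have wi : w \in flag_push A gs i by rewrite (proj2 bB) memv_span.
rewrite sL ?(mem_take wb) //; move: wi; rewrite ffunE => /(proj2 (levP w)) wi.
exact: subvP (flag_mono A wi) _ (memv_proj _ _).
Qed.

Lemma flag_exists V p (a : p.-tuple nat) : \dim {:V} = csize a ->
  exists A : flag V p, flag_type A = a.
Proof.
move=> Va; pose b := vbasis {:V}; pose s i := sumn (take i a).
have sumn_take i : (i < p)%N -> s i.+1 = (s i + nth 0%N a i)%N.
  by move=> ip; rewrite /s (take_nth 0%N) ?size_tuple // sumn_rcons.
have sp : s p = \dim {:V}.
  by rewrite /s take_oversize ?size_tuple // Va /csize sumnE.
have smono i j : (i <= j)%N -> (s i <= s j)%N.
  move=> ij; rewrite /s -(cat_take_drop i (take j a)) take_takel //.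
  by rewrite sumn_cat leq_addr.
have dimA i : (i <= p)%N -> \dim <<take (s i) b>> = s i.
  move=> ip; have : free (take (s i) b).
    by apply: (@catl_free _ _ (drop (s i) b)); rewrite cat_take_drop;
      exact: basis_free (vbasisP _).
  by move=> /eqP->; rewrite size_takel // size_tuple -sp smono.
have Aflag : is_flag [ffun i : 'I_p.+1 => <<take (s i) b>>%VS].
  apply/and3P; split; rewrite ?ffunE /=.
  - by rewrite /s take0 /= take0 span_nil.
  - rewrite sp take_oversize ?size_tuple //.
    by rewrite (span_basis (vbasisP _)).
  apply/forallP => i; rewrite !ffunE /=; apply: sub_span => x.
  have -> : take (s i) b = take (s i) (take (s i.+1) b)
    by rewrite take_takel ?smono.
  exact: mem_take.
exists (Flag Aflag); apply: eq_from_tnth => i; rewrite tnth_mktuple !ffunE /= .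
rewrite !dimA; try exact: ltnW; try by [].
by rewrite sumn_take // addKn (tnth_nth 0%N).
Qed.

Definition evalv V W (v : V) : 'Hom('Hom(V, W), W) :=
  linfun (fun f : 'Hom(V, W) => f v).

Lemma evalvE V W (v : V) (f : 'Hom(V, W)) : evalv W v f = f v.
Proof.
by rewrite linfun_linear // => a g h; rewrite add_lfunE scale_lfunE.
Qed.

(** A linear map is a free choice of images of basis vectors; here the j-th image ranges over
    [U j]. *)
Lemma dim_bigcap_evalv V W (b : seq V) (U : nat -> {vspace W}) :
  basis_of {:V} b ->
  \dim (\bigcap_(j < size b) (evalv W b`_j @^-1: U j)) =
    (\sum_(0 <= j < size b) \dim (U j))%N.
Proof.
move=> bV; have szb : size b = \dim {:V}.
  by rewrite (size_basis (X := in_tuple b) bV).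
pose P m := (\bigcap_(0 <= j < m) (evalv W b`_j @^-1: U j))%VS.
have PP m (f : 'Hom(V, W)) : reflect (forall j, (j < m)%N ->
  f b`_j \in U j) (f \in P m).
  elim: m => [|m IHm]; first by rewrite /P big_geq // memvf; left.
  rewrite /P big_nat_recr //= memv_cap -memv_preim evalvE.
  apply: (iffP andP) => [[/IHm fP fm] j|fP].
    by rewrite ltnS leq_eqVlt => /predU1P[->|/fP].
  by split; [apply/IHm => j jm; apply/fP/ltnW | apply: fP].
suff main m : (m <= size b)%N ->
    (\dim (P m) + m * \dim {:W} =
     \dim {:V} * \dim {:W} + \sum_(0 <= j < m) \dim (U j))%N.
  have := main _ (leqnn _); rewrite {2}szb addnC => /addnI.
  by rewrite /P big_mkord.
elim: m => [_|m IHm mb].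
  by rewrite /P !big_geq // mul0n !addn0 dimvf /= !dimvf.
have im : (evalv W b`_m @: P m)%VS = fullv.
  apply/vspaceP => w; rewrite memvf.
  have [|f fb] := lfun_basis bV (c := mkseq (fun j =>
    if j == m then w else 0) (size b)).
    by rewrite size_mkseq.
  have fE j : (j < size b)%N -> f b`_j = if j == m then w else 0.
    by move=> jb; rewrite -(nth_map 0 0) // fb nth_mkseq.
  apply/memv_imgP; exists f; last by rewrite evalvE fE // eqxx.
  apply/PP => j jm; rewrite fE ?(ltn_trans jm) // ifN ?mem0v //.
  by rewrite neq_ltn jm.
have imS : (evalv W b`_m @: P m.+1)%VS = U m.
  apply/vspaceP => w; apply/memv_imgP/idP => [[f /PP fP ->]|wU].
    by rewrite evalvE fP.
  have : w \in (evalv W b`_m @: P m)%VS by rewrite im memvf.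
  case/memv_imgP => f /PP fP wE; exists f => //; apply/PP => j.
  by rewrite ltnS leq_eqVlt => /predU1P[->|/fP //]; rewrite -evalvE -wE.
have kerS : (P m.+1 :&: lker (evalv W b`_m) = P m :&: lker (evalv W b`_m))%VS.
  rewrite /P big_nat_recr //= -capvA; congr (_ :&: _)%VS; apply/capv_idPr.
  apply/subvP => f; rewrite memv_ker -memv_preim => /eqP->; exact: mem0v.
have := IHm (ltnW mb); have := limg_ker_dim (evalv W b`_m) (P m).
have := limg_ker_dim (evalv W b`_m) (P m.+1).
rewrite kerS im imS big_nat_recr //= => <- <-.
by rewrite mulSn; lia.
Qed.

(** The dimension of the parabolic subalgebra of a flag. In an adapted basis, each vector may go
    anywhere in the smallest member containing it. *)
Lemma dim_homs V p (A : flag V p) :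
  ((\dim (homs A A)).*2 = \dim {:V} ^ 2 + cnormsq (flag_type A))%N.
Proof.
have [b [bV bA]] := adapted_exists A.
have szb : size b = \dim {:V}.
  by rewrite (size_basis (X := in_tuple b) bV).
(* The smallest member of the flag containing the j-th vector of the adapted basis. *)
pose U (j : nat) := (\bigcap_(i | (j < \dim (A i))%N) A i)%VS.
have -> : homs A A = (\bigcap_(j < size b) (evalv V b`_j @^-1: U j))%VS.
  apply/vspaceP => f; apply/memv_homs/idP => [fA|fU i].
    rewrite memvE; apply/subv_bigcapP => j _; rewrite -memvE -memv_preim evalvE.
    rewrite memvE; apply/subv_bigcapP => i ji; rewrite -memvE.
    apply: fA; rewrite bA memv_span //.
    rewrite -(nth_take 0 ji) mem_nth // size_takel //.
    by rewrite szb dimvS ?subvf.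
  move: i; apply/preservesP => i; rewrite {1}bA limg_span.
  apply/span_subvP => _ /mapP[u + ->] => /(nthP 0)[j].
  rewrite size_take_min leq_min => /andP[ji jb]; rewrite nth_take // => <-.
  move: fU; rewrite memvE => /subv_bigcapP/(_ (Ordinal jb) isT).
  rewrite -memvE -memv_preim evalvE memvE => /subv_bigcapP/(_ i ji).
  by rewrite -memvE.
rewrite dim_bigcap_evalv // szb.
pose F n := \dim (A (inord n)).
have F0 : F 0%N = 0%N.
  rewrite /F (_ : inord 0 = ord0) ?flag_ord0 ?dimv0 //.
  by apply/val_inj; rewrite /= inordK.
have Fp : F p = \dim {:V}.
  rewrite /F (_ : inord p = ord_max) ?flag_ord_max //.
  by apply/val_inj; rewrite /= inordK.
have Fle m n : (m <= n <= p)%N -> (F m <= F n)%N.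
  move=> /andP[mn np]; rewrite dimvS // flag_mono // !inordK ?ltnS //.
  exact: leq_trans np.
have Fi (i : 'I_p.+1) : F i = \dim (A i) by rewrite /F inord_val.
have Ustep n j : (n < p)%N -> (F n <= j < F n.+1)%N -> \dim (U j) = F n.+1.
  move=> np /andP[nj jn]; congr (\dim _); apply/eqP; rewrite eqEsubv.
  apply/andP; split; first exact: (bigcapv_inf _ jn).
  apply/subv_bigcapP => i; rewrite -Fi => ji; apply: flag_mono.
  rewrite inordK ?ltnS // ltnNge; apply/negP => i_n.
  have : (F i <= F n)%N by rewrite Fle // i_n ltnW.
  by rewrite leqNgt (leq_ltn_trans nj).
have -> : cnormsq (flag_type A) = (\sum_(0 <= n < p) (F n.+1 - F n) ^ 2)%N.
  rewrite /cnormsq big_tuple big_mkord; apply: eq_bigr => i _.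
  rewrite tnth_mktuple -!Fi /= /bump /= add1n.
  by [].
(* With d the size of the new block, the identity 2d(x + d) = (x + d)^2 - x^2 + d^2 gives the
   induction step. *)
rewrite -Fp; suff main m : (m <= p)%N ->
    ((\sum_(0 <= j < F m) \dim (U j)).*2 =
     F m ^ 2 + \sum_(0 <= n < m) (F n.+1 - F n) ^ 2)%N by exact: main.
elim: m => [_|m IHm mp]; first by rewrite F0 !big_geq.
have Fm : (F m <= F m.+1)%N by rewrite Fle // leqnSn.
rewrite (big_cat_nat _ Fm) //= doubleD IHm ?(ltnW mp) // big_nat_recr //=.
rewrite (_ : \sum_(F m <= j < F m.+1) _ = ((F m.+1 - F m) * F m.+1)%N);
  last first.
  rewrite (@eq_big_nat _ _ _ _ _ _ (fun=> F m.+1)) => [|j jm];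
    last exact: Ustep.
  by rewrite sum_nat_const_nat.
by move: Fm; rewrite -!mulnn; nia.
Qed.

End AdaptedBasis.

                                                          

(** * Rigidity: the two-term complex of a triple of flags and its Euler characteristic *)

Section Rigid.

Variables (K : fieldType) (p q r : nat).
Local Notation obj := (obj K p q r).
Implicit Types X Y Z R S : obj.

Definition flag_homs X Y : vectType K :=
  (subvs_of (homs (flagA X) (flagA Y)) * subvs_of (homs (flagB X) (flagB Y))
   * subvs_of (homs (flagC X) (flagC Y)))%type.

Definition mismatch_fun X Y (gA gB gC : 'End(Y)) (v : flag_homs X Y) :
    ('Hom(X, Y) * 'Hom(X, Y))%type :=
  ((gA \o vsval v.1.1)%VF - (gB \o vsval v.1.2)%VF,
   (gB \o vsval v.1.2)%VF - (gC \o vsval v.2)%VF).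

Lemma mismatch_linear X Y (gA gB gC : 'End(Y)) :
  linear (@mismatch_fun X Y gA gB gC).
Proof.
move=> k [[a b] c] [[a' b'] c']; rewrite /mismatch_fun /=.
by congr (_, _); apply/lfunP => x;
  rewrite !(comp_lfunE, add_lfunE, opp_lfunE, scale_lfunE) !linearP /=
    scalerDr addrACA.
Qed.

                                                                            
                                                            
(** When the g's are invertible, a morphism from X to Y with its flags moved by them is a common
    value gA a = gB b = gC c with a, b, c preserving the original flags. So the moved Hom space is
    the kernel of a map with fixed source and target, linear in the g's, and the pencil lemmas
    apply. *)
Definition mismatch X Y (gA gB gC : 'End(Y)) :
    'Hom(flag_homs X Y, ('Hom(X, Y) * 'Hom(X, Y))%type) :=
  linfun (@mismatch_fun X Y gA gB gC).

Lemma mismatchE X Y (gA gB gC : 'End(Y)) v :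
  mismatch X gA gB gC v = mismatch_fun gA gB gC v.
Proof. by rewrite linfun_linear //; apply: mismatch_linear. Qed.

Lemma mismatch_pencil X Y (gA gB gC hA hB hC : 'End(Y)) t :
  mismatch X (gA + t *: hA) (gB + t *: hB) (gC + t *: hC) =
  mismatch X gA gB gC + t *: mismatch X hA hB hC.
Proof.
apply/lfunP => v; rewrite add_lfunE scale_lfunE !mismatchE.
by congr (_, _); apply/lfunP => x;
  rewrite !(comp_lfunE, add_lfunE, opp_lfunE, scale_lfunE) scalerBr
    opprD addrACA.
Qed.

Section Moved.

Variables (Y : obj) (gA gB gC : 'End(Y)).
Hypotheses (gA0 : lker gA == 0%VS) (gB0 : lker gB == 0%VS) (gC0 :
  lker gC == 0%VS).

Definition moved : obj :=
  Obj (flag_push (flagA Y) (lker0_limgf gA0))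
      (flag_push (flagB Y) (lker0_limgf gB0))
      (flag_push (flagC Y) (lker0_limgf gC0)).

Lemma dim_push (V W : vectType K) n (A : flag V n) (g : 'Hom(V, W)) gs i :
  lker g == 0%VS -> \dim (flag_push A (gs : limg g = fullv) i) = \dim (A i).
Proof. by move=> /eqP g0; rewrite ffunE limg_dim_eq // g0 capv0. Qed.

Lemma dimvec_moved : dimvec moved = dimvec Y.
Proof. by apply/eq_dimvecP; split=> i; rewrite dim_push. Qed.

Lemma preserves_push (V W : vectType K) n (A : flag V n) (B : flag W n)
    (g : 'End(W)) (gs : limg g = fullv) (f : 'Hom(V, W)) : lker g == 0%VS ->
  preserves f A (flag_push B gs) <-> (g^-1 \o f)%VF \in homs A B.
Proof.
move=> g0; split=> [fAB|/memv_homs fAB i u uA].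
  apply/memv_homs => i u /fAB; rewrite ffunE comp_lfunE => /memv_imgP[v vB ->].
  by rewrite lker0_lfunK.
rewrite ffunE -(lker0_lfunVK g0 (f u)) -[g^-1%VF _]comp_lfunE.
exact/memv_img/fAB.
Qed.

Lemma mem_lker_mismatch X (v : flag_homs X Y) :
  (v \in lker (mismatch X gA gB gC)) =
    ((gA \o vsval v.1.1)%VF == (gB \o vsval v.1.2)%VF) &&
    ((gB \o vsval v.1.2)%VF == (gC \o vsval v.2)%VF).
Proof. by rewrite memv_ker mismatchE /mismatch_fun -pair_eqE /= !subr_eq0. Qed.

Lemma hom_moved X (v : flag_homs X Y) : v \in lker (mismatch X gA gB gC) ->
  (gA \o vsval v.1.1)%VF \in hom_space X moved.
Proof.
rewrite mem_lker_mismatch => /andP[/eqP ab /eqP bc].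
apply/(@homP _ _ _ _ X moved); split; apply/preserves_push => //.
- by rewrite lker0_compKf // subvsP.
- by rewrite ab lker0_compKf // subvsP.
- by rewrite ab bc lker0_compKf // subvsP.
Qed.

Lemma dim_hom_moved X :
  \dim (hom_space X moved) = \dim (lker (mismatch X gA gB gC)).
Proof.
pose F (v : flag_homs X Y) : 'Hom(X, Y) := (gA \o vsval v.1.1)%VF.
have Flin : linear F.
  move=> k u v; apply/lfunP => x.
  by rewrite !(comp_lfunE, add_lfunE, scale_lfunE) linearP.
rewrite -(@limg_dim_eq _ _ _ (linfun F)); last first.
  apply/eqP; rewrite -subv0; apply/subvP => -[[a b] c].
  rewrite memv_cap mem_lker_mismatch /= memv_ker linfun_linear // /F /=.
  move=> /andP[/andP[/eqP ab /eqP bc] /eqP a0]; rewrite memv0.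
  have z (g : 'End(Y)) (U : {vspace 'Hom(X, Y)}) (u : subvs_of U) :
      lker g == 0%VS -> (g \o vsval u)%VF = 0 -> u = 0.
    move=> g0 gu; apply: subvs_inj; apply/lfunP => x; apply: (lker0P g0).
    by rewrite -comp_lfunE gu zero_lfunE linear0.
  apply/eqP; congr (_, _, _).
  - exact: z gA0 a0.
  - by apply: z gB0 _; rewrite -ab.
  - by apply: z gC0 _; rewrite -bc -ab.
congr (\dim _); apply/vspaceP => f; apply/idP/memv_imgP.
  move=> /(@homP _ _ _ _ X moved)[/(preserves_push _ _ _ _ gA0) fA].
  move=> /(preserves_push _ _ _ _ gB0) fB /(preserves_push _ _ _ _ gC0) fC.
  exists (vsproj _ (gA^-1 \o f)%VF, vsproj _ (gB^-1 \o f)%VF, vsproj _ (gC^-1 \o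
    f)%VF).
    by rewrite mem_lker_mismatch /= !vsprojK // !lker0_compVKf // !eqxx.
  by rewrite linfun_linear // /F /= vsprojK // lker0_compVKf.
by move=> [v vker ->]; rewrite linfun_linear //; apply: hom_moved.
Qed.

End Moved.

Lemma lker0_id (V : vectType K) : lker (\1%VF : 'End(V)) == 0%VS.
Proof. by apply/lker0P => x y; rewrite !id_lfunE. Qed.

Lemma dim_hom_mismatch X Y :
  \dim (hom_space X Y) = \dim (lker (mismatch X (\1%VF : 'End(Y)) \1%VF \1%VF)).
Proof.
rewrite -(dim_hom_moved (lker0_id Y) (lker0_id Y) (lker0_id Y)).
congr (\dim _); apply/vspaceP => f.
pose Y1 := moved (lker0_id Y) (lker0_id Y) (lker0_id Y).
apply/(@homP K p q r X Y f)/(@homP K p q r X Y1 f) => -[fA fB fC];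
  split=> i u uX; first [have := fA i u uX | have := fB i u uX | have :=
    fC i u uX];
  by rewrite !ffunE !lim1g.
Qed.

(** The vanishing of Ext^1(X,X), as the vanishing of the cokernel of the complex; [rigid_open] shows
    that generic deformations of X along a pencil are then isomorphic to X. *)
Definition rigid X :=
  limg (mismatch X (\1%VF : 'End(X)) \1%VF \1%VF) = fullv.

Lemma rigidP X : rigid X <-> forall x y : 'End(X), exists a b c,
  [/\ a \in homs (flagA X) (flagA X), b \in homs (flagB X) (flagB X),
      c \in homs (flagC X) (flagC X), x = a - b & y = b - c].
Proof.
split=> [Xr x y|Xr].
  have : (x, y) \in limg (mismatch X (\1%VF : 'End(X)) \1%VF \1%VF).
    by rewrite Xr memvf.
  move=> /memv_imgP[[[a b] c] _]; rewrite mismatchE /mismatch_fun /=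
    !comp_lfun1l.
  by case=> -> ->; exists (vsval a), (vsval b), (vsval c); split=> //;
    apply: subvsP.
apply/vspaceP => -[x y]; rewrite memvf; apply/memv_imgP.
have [a [b [c [aA bB cC -> ->]]]] := Xr x y.
exists (vsproj _ a, vsproj _ b, vsproj _ c); rewrite ?memvf //.
by rewrite mismatchE /mismatch_fun /= !vsprojK // !comp_lfun1l.
Qed.

Definition qdim X := (\dim (homs (flagA X) (flagA X)) +
  \dim (homs (flagB X) (flagB X)) + \dim (homs (flagC X) (flagC X)))%N.

(** Rank-nullity for [mismatch]. With [tits_qdim] it reads Q <= dim End(X), with equality exactly
    when X is rigid. *)
Lemma dim_hom_rigid X :
  (qdim X <= \dim (hom_space X X) + 2 * \dim {:X} ^ 2)%N /\
  (rigid X <-> (\dim (hom_space X X) + 2 * \dim {:X} ^ 2 = qdim X)%N).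
Proof.
rewrite dim_hom_mismatch; set M := mismatch _ _ _ _.
have codim : \dim {:('Hom(X, X) * 'Hom(X, X))%type} = (2 * \dim {:X} ^ 2)%N.
  rewrite !dimvf -[LHS]/(dim X * dim X + dim X * dim X)%N.
  by rewrite addnn mulnn mul2n.
have -> : qdim X = \dim {:flag_homs X X} by rewrite !dimvf.
rewrite -codim -(dim_lker_limg M) leq_add2l dimvS ?subvf //; split=> //.
split=> [->//|/addnI dM]; apply/eqP.
by rewrite eqEdim subvf dM /=.
Qed.

Lemma tits_qdim X :
  tits (dimvec X) = (qdim X)%:R - (2 * \dim {:X} ^ 2)%:R.
Proof.
have /(congr1 (fun n => n%:R : rat)) : (2 * qdim X = 3 * \dim {:X} ^ 2 +
    (cnormsq (dimvec X).1.1 + cnormsq (dimvec X).1.2 + cnormsq (dimvec X).2))%N.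
  have := dim_homs (flagA X); have := dim_homs (flagB X).
  have := dim_homs (flagC X); rewrite /qdim /=; lia.
move: (qdim X) => Q; rewrite /tits csize_flag_type -!mulnn !(natrD, natrM).
lra.
Qed.

Lemma tits1P X : tits (dimvec X) = 1 <-> qdim X = (2 * \dim {:X} ^ 2).+1.
Proof.
rewrite tits_qdim; split=> [/eqP|->]; last by rewrite -natr1 addrC addKr.
by rewrite subr_eq addrC natr1 Num.Theory.eqr_nat => /eqP.
Qed.

End Rigid.

                    

(** * Consequences of finiteness of the number of orbits *)

Section FiniteType.

Variables (K : closedFieldType) (p q r : nat).
Local Notation obj := (obj K p q r).
Implicit Types X Y Z R S : obj.

Definition obj_of (V : vectType K) (t : flag V p * flag V q * flag V r) : obj :=
  Obj t.1.1 t.1.2 t.2.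

Definition flags_of X : flag X p * flag X q * flag X r :=
  (flagA X, flagB X, flagC X).

Lemma in_FlP (V : vectType K) (d : triple p q r) t :
  @in_Fl K p q r V d t <-> dimvec (obj_of t) = d.
Proof.
case: d => [[a b] c]; rewrite /in_Fl /dimvec /=.
by split=> [[-> -> ->]|[-> -> ->]].
Qed.

Lemma same_orbit_iso (V : vectType K) t u :
  @same_orbit K p q r V t u <-> iso (obj_of t) (obj_of u).
Proof.
split=> [[g [h [[hg gh] gA gB gC]]]|/isoP[f [g [/homP[fA fB fC] /homP[gA gB gC]
  fK gK]]]].
  have hK : cancel g h by move=> x; rewrite -comp_lfunE hg id_lfunE.
  have gK : cancel h g by move=> x; rewrite -comp_lfunE gh id_lfunE.
  have inv n (A B : flag V n) : flag_moved g A B -> preserves h B A.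
    by move=> gAB i u'; rewrite -gAB => /memv_imgP[v vA ->]; rewrite hK.
  apply: (@isoI _ _ _ _ (obj_of t) (obj_of u) g h) => //; apply/homP;
    split=> /=.
  - by apply/preservesP => i; rewrite gA.
  - by apply/preservesP => i; rewrite gB.
  - by apply/preservesP => i; rewrite gC.
  - exact: inv.
  - exact: inv.
  - exact: inv.
exists f, g; split.
- by split; apply/lfunP => x; rewrite comp_lfunE ?fK ?gK id_lfunE.
- move=> i; apply/vspaceP => x; apply/memv_imgP/idP => [[y yA ->]|xA];
    first exact: fA.
  by exists (g x); [exact: gA | rewrite gK].
- move=> i; apply/vspaceP => x; apply/memv_imgP/idP => [[y yA ->]|xA];
    first exact: fB.
  by exists (g x); [exact: gB | rewrite gK].
- move=> i; apply/vspaceP => x; apply/memv_imgP/idP => [[y yA ->]|xA];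
    first exact: fC.
  by exists (g x); [exact: gC | rewrite gK].
Qed.

(** Adding the fixed object Z is injective on isomorphism classes by [sum_cancel], so finitely many
    classes of sums leave finitely many classes of first summands. *)
Lemma finite_type_summand Y Z :
  finite_type K (dimvec (sum_obj Y Z)) -> finite_type K (dimvec Y).
Proof.
move=> fin V Vdim.
have Vdim' : \dim {:(V * Z)%type} = csize (dimvec (sum_obj Y Z)).1.1.
  by move: Vdim; rewrite !csize_flag_type dim_sum_obj !dimvf /= => <-.
have [s sP] := fin _ Vdim'.
suff [s' s'P] : exists s' : seq (flag V p * flag V q * flag V r),
    forall t : flag V p * flag V q * flag V r, in_Fl (dimvec Y) t ->
      (exists2 u, u \in s & iso (obj_of u) (sum_obj (obj_of t) Z)) ->
    exists2 t', t' \in s' & iso (obj_of t') (obj_of t).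
  exists s' => t td; have [|u us] := sP (flags_of (sum_obj (obj_of t) Z)).
    apply/in_FlP; move: td => /in_FlP/eq_dimvecP[tA tB tC].
    by apply/eq_dimvecP; split=> i /=; rewrite !dim_flag_sum ?tA ?tB ?tC.
  move=> /same_orbit_iso ut; have [|t' t's' t't] := s'P t td; first by exists u.
  by exists t' => //; apply/same_orbit_iso.
elim: s {sP} => [|u s [s' s'P]]; first by exists [::] => t _ [].
(* For each representative u, keep one t0 with u isomorphic to its sum with Z, if there is one. *)
have [[t0 [t0d t0u]]|no] := classic (exists t0 :
  flag V p * flag V q * flag V r, in_Fl (dimvec Y) t0 /\
    iso (obj_of u) (sum_obj (obj_of t0) Z)).
  exists (t0 :: s') => t td [u']; rewrite inE => /predU1P[->|u's] u't.
    exists t0; rewrite ?mem_head //.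
    by apply: (@sum_cancel _ _ _ _ _ _ Z); apply: iso_trans (iso_sym t0u) u't.
  have [|t' t's' t't] := s'P t td; first by exists u'.
  by exists t'; rewrite // inE t's' orbT.
exists s' => t td [u']; rewrite inE => /predU1P[->|u's] u't.
  by case: no; exists t.
by apply: s'P => //; exists u'.
Qed.

Lemma finite_type_iso_summand X Y Z :
  iso X (sum_obj Y Z) -> finite_type K (dimvec X) -> finite_type K (dimvec Y).
Proof. by move=> /iso_dimvec->; apply: finite_type_summand. Qed.

Lemma dim_hom_iso X X' Y :
  iso X X' -> \dim (hom_space X Y) = \dim (hom_space X' Y).
Proof.
have le Z Z' (f : 'Hom(Z', Z)) (g : 'Hom(Z, Z')) : f \in hom_space Z' Z ->
    cancel g f -> (\dim (hom_space Z Y) <= \dim (hom_space Z' Y))%N.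
  move=> fh gK; pose F := linfun (sandwich (\1%VF : 'End(Y)) f).
  have FE h : F h = (h \o f)%VF.
    by rewrite linfun_linear ?/sandwich ?comp_lfun1l //; apply: sandwich_linear.
  rewrite -(@limg_dim_eq _ _ _ F); last first.
    apply/eqP; rewrite -subv0; apply/subvP => h /memv_capP[_].
    rewrite memv_ker FE memv0 => /eqP hf; apply/eqP/lfunP => z.
    by rewrite -[z]gK -[h _]comp_lfunE hf !zero_lfunE.
  apply: dimvS; apply/subvP => _ /memv_imgP[h hh ->].
  by rewrite FE hom_comp.
move=> /isoP[f [g [fh gh fK gK]]]; apply/eqP.
by rewrite eqn_leq (le _ _ g f gh fK) (le _ _ f g fh gK).
Qed.

Lemma leq_sum_tight (T : eqType) (s : seq T) (a b : T -> nat) :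
  (forall u, u \in s -> a u <= b u)%N ->
    (\sum_(u <- s) b u <= \sum_(u <- s) a u)%N ->
  forall u, u \in s -> (b u <= a u)%N.
Proof.
elim: s => // x s IHs le; rewrite !big_cons => ba u.
have le_s v : v \in s -> (a v <= b v)%N by move=> vs; rewrite le // inE vs orbT.
have sum_le : (\sum_(v <- s) a v <= \sum_(v <- s) b v)%N.
  by rewrite big_seq [leqRHS]big_seq leq_sum.
have := le x (mem_head _ _); rewrite inE => xle /predU1P[->|]; first by lia.
by apply: IHs => //; lia.
Qed.

(** Replaces the existence of an open orbit. Flags minimizing the total dim Hom from the
    representatives have constant Hom dimensions under generic deformation, including Hom from the
    object itself; [generic_ker_pencil] applied to the identity then yields surjectivity. *)
Lemma rigid_exists X : finite_type K (dimvec X) ->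
  exists2 Y : obj, dimvec Y = dimvec X & rigid Y.
Proof.
move=> fin; have [|s sP] := fin X; first by rewrite csize_flag_type.
pose h (u t : flag X p * flag X q * flag X r) :=
  \dim (hom_space (obj_of u) (obj_of t)).
have [|t td tmin] := @minimizer _ (in_Fl (dimvec X)) (fun t =>
  \sum_(u <- s) h u t)%N
  (flags_of X); first by apply/in_FlP.
pose Y := obj_of t; exists Y; first exact/in_FlP.
have [u0 u0s /same_orbit_iso u0t] := sP t td.
apply/rigidP => x y.
have gen (g : 'End(Y)) : generic (fun c => lker (\1%VF + c *: g) == 0%VS).
  exact: generic_lker0 (lker0_id _).
pose M (u : flag X p * flag X q * flag X r) :=
  mismatch (obj_of u) (\1%VF : 'End(Y)) \1%VF \1%VF.
(* The direction (x, 0, -y) is chosen because it sends the triple of identities to (x, y), the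
   target to be reached. *)
pose D (u : flag X p * flag X q * flag X r) := mismatch (obj_of u) x 0 (- y).
have pencil : generic (fun c => (\dim (lker (mismatch Y (\1%VF :
  'End(Y)) \1%VF \1%VF))
    <= \dim (lker (mismatch Y (\1%VF : 'End(Y)) \1%VF \1%VF +
                   c *: mismatch Y x 0 (- y))%R))%N).
  have Ms : generic (fun c => forall u, u \in s ->
      (\dim (lker (M u + c *: D u)%R) <= \dim (lker (M u)))%N).
    apply: generic_all => u us; apply: generic_imp (generic_dim_limg (M u)
      (D u)) => c le.
    rewrite -(leq_add2r (\dim (limg (M u)))) dim_lker_limg.
    by rewrite -(dim_lker_limg (M u + c *: D u)) leq_add2l.
  apply: generic_imp (generic_and (generic_and (gen x) (gen 0))
    (generic_and (gen (- y)) Ms)).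
  move=> c [[cA cB] [cC cs]].
  pose t' := flags_of (moved (Y := Y) cA cB cC).
  have t'd : in_Fl (dimvec X) t'.
    apply/in_FlP; rewrite -[obj_of t']/(moved cA cB cC) dimvec_moved.
    exact/in_FlP.
  have hE u : \dim (lker (M u + c *: D u)%R) = h u t'.
    by rewrite -mismatch_pencil -(dim_hom_moved cA cB cC).
  (* No term grows by semicontinuity and the sum cannot drop by minimality, so the term of [u0], the
     representative of [t] itself, is unchanged. *)
  have := leq_sum_tight (s := s) (a := h^~ t') (b := h^~ t) _ (tmin _ t'd) u0s.
  rewrite /h !(dim_hom_iso _ u0t) -!dim_hom_mismatch -mismatch_pencil.
  rewrite -(dim_hom_moved cA cB cC); apply=> u us.
  by have := cs u us; rewrite hE -dim_hom_mismatch.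
have v1 (n : nat) (A : flag X n) : \1%VF \in homs A A.
  by apply/memv_homs => i u uA; rewrite id_lfunE.
pose v : flag_homs Y Y := (vsproj _ \1%VF, vsproj _ \1%VF, vsproj _ \1%VF).
have : mismatch Y x 0 (- y) v \in limg (mismatch Y (\1%VF :
  'End(Y)) \1%VF \1%VF).
  apply: (generic_ker_pencil pencil).
  by rewrite mismatchE /mismatch_fun /= !vsprojK // !subrr.
move=> /memv_imgP[[[a b] c] _]; rewrite !mismatchE /mismatch_fun /=.
rewrite !vsprojK // !comp_lfun1l !comp_lfun1r subr0 sub0r opprK.
by case=> -> ->; exists (vsval a), (vsval b), (vsval c); split=> //;
  apply: subvsP.
Qed.

End FiniteType.

                                                         

(** * Ringel's argument: rigidity of smaller indecomposables excludes nilpotent endomorphisms *)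

Lemma lfun_factor (K : fieldType) (U V W : vectType K) (h : 'Hom(U, V))
    (k : 'Hom(U, W)) :
  (lker h <= lker k)%VS -> exists x : 'Hom(V, W), (k = x \o h)%VF.
Proof.
move=> hk; exists (k \o h^-1)%VF; apply/lfunP => u; rewrite !comp_lfunE.
apply/eqP; rewrite -subr_eq0 -linearB -memv_ker; apply: (subvP hk).
by rewrite memv_ker linearB /= [h (h^-1%VF _)]limg_lfunVK ?subrr // memv_img
  ?memvf.
Qed.

Lemma exists_eigenvalue (K : closedFieldType) (V : vectType K) (f : 'End(V)) :
  \dim {:V} != 0%N -> exists c, lker (f - c *: \1%VF) != 0%VS.
Proof.
move=> V0; pose e := vbasis {:V}; have eb : basis_of {:V} e by exact: vbasisP.
have /closed_rootP[c] : size (char_poly (mxof e e f)) != 1%N.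
  by rewrite size_char_poly eqSS.
rewrite -eigenvalue_root_char => cf; exists c.
by rewrite -[lker _]/(leigenspace f c) (leigenspaceE eb) vsof_eq0.
Qed.

Section Ringel.

Variables (K : closedFieldType) (p q r : nat).
Local Notation obj := (obj K p q r).
Local Notation zero := (zero_obj K p q r).
Implicit Types X Y Z R S : obj.

Lemma iso_summand_in (s : seq obj) Y : List.In Y s ->
  exists S, iso (direct_sum s) (sum_obj Y S).
Proof.
elim: s => //= Z s IHs [->|/IHs[S YS]]; first by exists (direct_sum s);
  apply: iso_refl.
exists (sum_obj Z S); apply: iso_trans (iso_sum (iso_refl _) YS) _.
exact: iso_sumCA.
Qed.

Lemma nonzero_component (s : seq obj) Z (f : 'Hom(Z, direct_sum s)) : f != 0 ->
  exists R (i : 'Hom(R, direct_sum s)) (t : 'Hom(direct_sum s, R)),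
    [/\ List.In R s, i \in hom_space R (direct_sum s),
        t \in hom_space (direct_sum s) R, cancel i t & (t \o f)%VF != 0].
Proof.
elim: s f => [|Y s IHs] /= f f0.
  case/eqP: f0; apply/lfunP => z; rewrite zero_lfunE.
  by rewrite [LHS]thinmx0 [RHS]thinmx0.
pose S := direct_sum s.
case: (eqVneq (psnd Y S \o f)%VF 0) => [f2|/IHs[R [i [t [Rs ih th iK tf]]]]].
  exists Y, (pinl Y S), (pfst Y S); split.
  - by left.
  - exact: hom_inl.
  - exact: hom_fst.
  - by move=> y; rewrite pinlE pfstE.
  apply: contraNneq f0 => f1; apply/eqP/lfunP => z.
  have := congr1 (fun g : 'Hom(Z, Y) => g z) f1.
  have := congr1 (fun g : 'Hom(Z, S) => g z) f2.
  rewrite !comp_lfunE !zero_lfunE pfstE psndE => f2z f1z.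
  by rewrite [LHS]surjective_pairing f1z f2z.
exists R, (pinr Y S \o i)%VF, (t \o psnd Y S)%VF; split.
- by right.
- exact: (@hom_comp _ _ _ _ R S (sum_obj Y S) _ _ (hom_inr Y S) ih).
- exact: (@hom_comp _ _ _ _ (sum_obj Y S) S R _ _ th (hom_snd Y S)).
- by move=> z; rewrite !comp_lfunE pinrE psndE iK.
- by rewrite -comp_lfunA.
Qed.

(** Take f nonzero of square zero with least rank, and an indecomposable summand R of ker f in which
    im f has a nonzero component. Minimality embeds X/ker f into R. The extension of X/ker f by ker
    f, pushed out to R, then splits because R has no self-extensions. So R would be a proper nonzero
    summand of X. *)
Lemma no_square_zero_endo X (f : 'End(X)) : indecomposable X ->
  finite_type K (dimvec X) ->
  (forall R, indecomposable R -> finite_type K (dimvec R) ->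
     (\dim {:R} < \dim {:X})%N -> rigid R) ->
  f \in hom_space X X -> (f \o f)%VF = 0 -> f = 0.
Proof.
move=> Xi Xfin Rrigid fh ff; apply/eqP; apply: contraT => f0.
pose sqz (g : 'End(X)) := [/\ g \in hom_space X X, (g \o g)%VF = 0 & g != 0].
have [|{fh ff f0}f [fh ff f0] fmin] := @minimizer _ sqz (fun g =>
  \dim (limg g)) f.
  by split.
pose N := lker f; pose ON := sub_obj N.
have fN y : f y \in N by rewrite memv_ker -comp_lfunE ff zero_lfunE.
pose c := sub_corestr N f.
have ch : c \in hom_space X ON by exact: hom_sub_corestr.
have cE x : vsval (c x) = f x by rewrite sub_corestrK.
have c0 : c != 0.
  apply: contraNneq f0 => c0; apply/eqP/lfunP => x.
  by rewrite -cE c0 !zero_lfunE.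
have [s [si NS]] := krull_schmidt_exists ON.
have [u [u' [uh u'h uK u'K]]] := (proj1 (isoP _ _)) NS.
have uc0 : (u \o c)%VF != 0.
  apply: contraNneq c0 => uc; apply/eqP/lfunP => x.
  by rewrite -[c x]uK -[u (c x)]comp_lfunE uc !zero_lfunE linear0.
have [R [i [t [Rs ih th iK tuc0]]]] := nonzero_component uc0.
have Ri : indecomposable R by move/List.Forall_forall: si => /(_ _ Rs).
pose j := (u' \o i)%VF; pose w := (t \o u)%VF.
have jh : j \in hom_space R ON by exact: hom_comp.
have wh : w \in hom_space ON R by exact: hom_comp.
have jK : cancel j w by move=> z; rewrite !comp_lfunE u'K iK.
pose wc := (w \o c)%VF.
have wc0 : wc != 0 by rewrite /wc /w -comp_lfunA.
have wch : wc \in hom_space X R by exact: hom_comp.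
have wcN (z : ON) : wc (vsval z) = 0.
  have cz : c (vsval z) = 0.
    by apply: subvs_inj; rewrite cE linear0; apply/eqP;
      rewrite -memv_ker subvsP.
  by rewrite comp_lfunE cz linear0.
pose k : 'Hom(R, X) := (sub_incl N \o j)%VF.
have kE z : k z = vsval (j z) by rewrite comp_lfunE sub_inclE.
have kh : k \in hom_space R X by rewrite hom_comp ?hom_sub_incl.
have wck z : wc (k z) = 0 by rewrite kE wcN.
have kinj : injective k.
  by move=> y z; rewrite !kE => /subvs_inj; apply: can_inj jK _ _.
                                                                       
(* The composite of [wc] with the inclusion [k] is again nonzero of square zero, and its kernel
   contains ker f; least rank gives equality. *)
have kerf : lker wc = lker f.
  have kerE : lker (k \o wc)%VF = lker wc.
    apply/vspaceP => x; rewrite !memv_ker comp_lfunE.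
    by apply/eqP/eqP => [|->]; rewrite ?linear0 // -(linear0 k) => /kinj.
  have sub : (lker f <= lker wc)%VS.
    apply/subvP => x; rewrite !memv_ker => /eqP fx.
    have cx : c x = 0 by apply: subvs_inj; rewrite cE fx linear0.
    by rewrite comp_lfunE cx linear0.
  apply/eqP; rewrite eq_sym eqEdim sub /= -kerE.
  have kwc : sqz (k \o wc)%VF.
    split; first exact: hom_comp.
      apply/lfunP => x; rewrite comp_lfunE [(k \o wc)%VF x]comp_lfunE.
      by rewrite [LHS]comp_lfunE wck linear0 zero_lfunE.
    apply: contraNneq wc0 => kwc; apply/eqP/lfunP => x; apply: kinj.
    by rewrite -[k (wc x)]comp_lfunE kwc !zero_lfunE linear0.
  rewrite -(leq_add2r (\dim (limg f))) dim_lker_limg.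
  by rewrite -(dim_lker_limg (k \o wc)%VF) leq_add2l fmin.
pose W := subvs_of (limg f).
pose g : 'Hom(X, W) := (linfun (vsproj (limg f)) \o f)%VF.
have gE x : vsval (g x) = f x.
  by rewrite comp_lfunE lfunE /= vsprojK // memv_img ?memvf.
have gs : limg g = fullv.
  apply/vspaceP => y; rewrite memvf; apply/memv_imgP.
  have /memv_imgP[x _ yx] := subvsP y.
  by exists x; rewrite ?memvf //; apply: subvs_inj; rewrite gE.
have kerg : limg (sub_incl N) = lker g.
  apply/vspaceP => x; rewrite memv_ker; apply/memv_imgP/eqP => [[z _ ->]|gx].
    apply: subvs_inj; rewrite gE sub_inclE linear0.
    by apply/eqP; rewrite -memv_ker subvsP.
  have xN : x \in N by rewrite memv_ker -gE gx linear0.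
  by exists (Subvs xN); rewrite ?memvf // sub_inclE.
pose OI := Obj (flag_push (flagA X) gs) (flag_push (flagB X) gs)
               (flag_push (flagC X) gs) : obj.
(* X is an extension of [OI] by [ON], so its dimension vector is that of their sum. This gives
   finite type of [ON], although [ON] need not be a summand of X. *)
have Xdim : dimvec X = dimvec (sum_obj ON OI).
  apply/eq_dimvecP; split=> l; rewrite dim_flag_sum;
    exact: dim_flag_exact (lker_vsval _) gs l kerg.
have Nfin : finite_type K (dimvec ON).
  by apply: (@finite_type_summand _ _ _ _ ON OI); rewrite -Xdim.
have [S RS] := iso_summand_in Rs.
have NRS := iso_trans NS RS.
have Rfin := finite_type_iso_summand NRS Nfin.
have RltX : (\dim {:R} < \dim {:X})%N.
  have := iso_dim_carrier NRS; rewrite dim_sum_obj (dimvec_dim Xdim)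
    dim_sum_obj => ->.
  have : (0 < \dim {:OI})%N.
    rewrite dimvf lt0n -[dim _]/(\dim (limg f)) dimv_eq0.
    apply: contraNneq f0 => f0; apply/eqP/lfunP => x; rewrite zero_lfunE.
    by apply/eqP; rewrite -memv0 -f0 memv_img ?memvf.
  by move=> I0; rewrite -addnA -[ltnLHS]addn0 ltn_add2l addn_gt0 I0 orbT.
have /rigidP Rr := Rrigid R Ri Rfin RltX.
                                                                              
                                                                        
(* Each flag taken alone allows an extension of [w] from ker f to X. The three extensions differ by
   maps vanishing on ker f, hence factoring through [wc]. *)
have ret n (A : flag X n) (B : flag R n) (AN : flag ON n) :
    (forall l z, (z \in AN l) = (vsval z \in A l)) -> preserves w AN B ->
    exists2 rA : 'Hom(X, R), preserves rA A B & forall z :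
      ON, rA (vsval z) = w z.
  move=> ANE wA; have [sg sgK sgA] := flag_section A gs.
  pose tA : 'End(X) := (\1 - (sg \o g))%VF.
  have tAE x : tA x = x - sg (g x).
    by rewrite add_lfunE opp_lfunE comp_lfunE id_lfunE.
  have tN x : tA x \in N.
    by rewrite memv_ker -gE tAE linearB /= sgK subrr.
  exists (w \o sub_corestr N tA)%VF.
    move=> l x xA; rewrite comp_lfunE; apply: wA; rewrite ANE sub_corestrK //.
    rewrite tAE memvB //; apply: sgA.
    by rewrite ffunE memv_img.
  move=> z; rewrite comp_lfunE; congr (w _); apply: subvs_inj.
  rewrite sub_corestrK // tAE.
  have -> : g (vsval z) = 0.
    by apply: subvs_inj; rewrite gE linear0; apply/eqP;
      rewrite -memv_ker subvsP.
  by rewrite linear0 subr0.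
have pullE n (A : flag X n) l (z : subvs_of N) :
    (z \in flag_pull A (lker_vsval N) l) = (vsval z \in A l).
  by rewrite memv_flag_pull lfunE.
move: (wh) => /homP[wA wB wC].
have [rA rAh rAN] := ret _ _ _ _ (pullE _ (flagA X)) wA.
have [rB rBh rBN] := ret _ _ _ _ (pullE _ (flagB X)) wB.
have [rC rCh rCN] := ret _ _ _ _ (pullE _ (flagC X)) wC.
have diff (r1 r2 : 'Hom(X, R)) : (forall z : ON, r1 (vsval z) = w z) ->
    (forall z : ON, r2 (vsval z) = w z) -> exists x, r1 - r2 = (x \o wc)%VF.
  move=> r1N r2N; apply: lfun_factor; rewrite kerf; apply/subvP => x xN.
  rewrite memv_ker add_lfunE opp_lfunE.
  by have := r1N (Subvs xN); have := r2N (Subvs xN) => /= -> ->; rewrite subrr.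
have [x xE] := diff _ _ rAN rBN; have [y yE] := diff _ _ rBN rCN.
have [a [b [d [aA bB dC xab ybd]]]] := Rr x y.
(* Rigidity of R corrects the three extensions to one common map [rho], a morphism. Since [wc] kills
   the image of [k], it still retracts [k]. *)
pose rho := rA - (a \o wc)%VF.
have shift (r1 r2 : 'Hom(X, R)) (e1 e2 z : 'End(R)) : r1 - r2 = (z \o wc)%VF ->
    z = e1 - e2 -> r1 - (e1 \o wc)%VF = r2 - (e2 \o wc)%VF.
  move=> r12 zE; rewrite -(subrK r2 r1) r12 zE comp_lfunDl comp_lfunNl.
  by rewrite addrC addrA addKr addrC.
have rhoB : rho = rB - (b \o wc)%VF by exact: shift xE xab.
have rhoC : rho = rC - (d \o wc)%VF by rewrite rhoB; exact: shift yE ybd.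
have rhoh : rho \in hom_space X R.
  move: (wch) => /homP[wcA wcB wcC].
  have prB n (A : flag X n) (B : flag R n) r1 e : preserves r1 A B ->
      preserves wc A B -> e \in homs B B -> preserves (r1 - (e \o wc)%VF) A B.
    move=> r1h wch' /memv_homs eh l v vA.
    by rewrite add_lfunE opp_lfunE comp_lfunE memvB //;
      [apply: r1h | apply/eh/wch'].
  apply/homP; split; first exact: prB.
    by rewrite rhoB; apply: prB.
  by rewrite rhoC; apply: prB.
have [|S' XRS'] := split_summand kh rhoh.
  by move=> z; rewrite add_lfunE opp_lfunE [(a \o wc)%VF _]comp_lfunE wck
    linear0 subr0 kE rAN jK.
have [R0|/iso_zeroP S0] := proj2 Xi _ _ XRS'; first by case: (proj1 Ri).
by move: RltX; rewrite (iso_dim_carrier XRS') dim_sum_obj S0 addn0 ltnn.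
Qed.

End Ringel.

                                              

(** * Indecomposables of finite type, uniqueness of rigid objects, and the classification *)

Section Main.

Variables (K : closedFieldType) (p q r : nat).
Local Notation obj := (obj K p q r).
Local Notation zero := (zero_obj K p q r).
Implicit Types X Y Z R S : obj.


(** If f^k = 0 with k >= 2, then f^(k-1) has square zero and so vanishes; descend on k. *)
Lemma no_nilpotent_endo X (f : 'End(X)) k : indecomposable X ->
  finite_type K (dimvec X) ->
  (forall R, indecomposable R -> finite_type K (dimvec R) ->
     (\dim {:R} < \dim {:X})%N -> rigid R) ->
  f \in hom_space X X -> (forall x, iter k f x = 0) -> f = 0.
Proof.
move=> Xi Xfin Rrigid fh.
elim/ltn_ind: k => -[|k] IHk fk.
  by apply/lfunP => x; rewrite zero_lfunE -[RHS](fk (f x)).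
case: k => [|k] in IHk fk *; first by apply/lfunP => x;
  rewrite zero_lfunE -[RHS](fk x).
apply: (IHk k.+1) => // x.
pose pw n := iter n (fun h => f \o h)%VF \1%VF.
have pwE n z : pw n z = iter n f z.
  by elim: n => [|n IHn]; rewrite /= ?id_lfunE // comp_lfunE IHn.
have pwh n : pw n \in hom_space X X.
  by elim: n => [|n IHn]; rewrite /= ?hom_id // hom_comp.
rewrite -pwE (_ : pw k.+1 = 0) ?zero_lfunE //.
apply: no_square_zero_endo => //; apply/lfunP => y.
by rewrite [LHS]comp_lfunE !pwE -iterD addSn -addnS addnC iterD fk zero_lfunE.
Qed.

(** Subtract an eigenvalue: the difference is singular, hence nilpotent by locality, hence zero. *)
Lemma indecomposable_brick X (f : 'End(X)) : indecomposable X ->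
  finite_type K (dimvec X) ->
  (forall R, indecomposable R -> finite_type K (dimvec R) ->
     (\dim {:R} < \dim {:X})%N -> rigid R) ->
  f \in hom_space X X -> exists c, f = c *: \1%VF.
Proof.
move=> Xi Xfin Rrigid fh.
have X0 : \dim {:X} != 0%N by apply/eqP => /iso_zeroP; apply: (proj1 Xi).
have [c fc] := exists_eigenvalue f X0; exists c.
have fch : f - c *: \1%VF \in hom_space X X by rewrite memvB ?memvZ ?hom_id.
have [fc0|[k fk]] := indecomposable_local Xi fch; first by rewrite fc0 in fc.
by apply/eqP; rewrite -subr_eq0; apply/eqP; apply: no_nilpotent_endo fk.
Qed.

Lemma qdim_dimvec X Y : dimvec X = dimvec Y -> qdim X = qdim Y.
Proof.
move=> XY; have := tits_qdim X; rewrite XY tits_qdim (dimvec_dim XY).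
by move=> /addIr/eqP; rewrite Num.Theory.eqr_nat => /eqP.
Qed.

Lemma dim_hom_gt0 X : \dim {:X} != 0%N -> (0 < \dim (hom_space X X))%N.
Proof.
move=> X0; rewrite lt0n dimv_eq0; apply: contraNneq X0 => h0.
have := hom_id X; rewrite h0 memv0 => /eqP id0.
rewrite dimv_eq0 -subv0; apply/subvP => x _.
by rewrite memv0 -[x]id_lfunE id0 zero_lfunE.
Qed.

(** End(X) is one-dimensional by induction, so Q <= 1; a rigid object with the same dimension vector
    has a nonzero endomorphism space of dimension Q, so Q >= 1. Equality makes X itself rigid. *)
Lemma indecomposable_rigid X : indecomposable X -> finite_type K (dimvec X) ->
  rigid X /\ tits (dimvec X) = 1.
Proof.
have [n] := ubnP (\dim {:X}); elim: n X => // n IHn X;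
  rewrite ltnS => Xn Xi Xfin.
have X0 : \dim {:X} != 0%N by apply/eqP => /iso_zeroP; apply: (proj1 Xi).
have hom1 : (\dim (hom_space X X) <= 1)%N.
  suff : (hom_space X X <= <[\1%VF]>)%VS.
    by move=> /dimvS/leq_trans; apply; rewrite dim_vline leq_b1.
  apply/subvP => f fh.
  have [|c ->] := indecomposable_brick Xi Xfin _ fh.
    by move=> R Ri Rfin RX; have [] := IHn R (leq_trans RX Xn) Ri Rfin.
  by rewrite memvZ ?memv_line.
have [Y YX Yr] := rigid_exists Xfin.
have qYX := qdim_dimvec YX; have dYX := dimvec_dim YX.
have := dim_hom_gt0 (X := Y); rewrite dYX => /(_ X0) hY.
have := proj1 (proj2 (dim_hom_rigid Y)) Yr; rewrite dYX qYX => hq.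
have [le Xr] := dim_hom_rigid X.
by split; [apply/Xr; lia | apply/tits1P; lia].
Qed.

(** By surjectivity of [mismatch] at t = 0, the identity of X extends to morphisms from X to its
    deformations, and these remain injective for generic t. *)
Lemma rigid_open X (gA gB gC : 'End(X)) : rigid X ->
  generic (fun t : K => forall (cA : lker (\1%VF + t *: gA) == 0%VS)
    (cB : lker (\1%VF + t *: gB) == 0%VS) (cC : lker (\1%VF + t *: gC) == 0%VS),
    iso X (moved cA cB cC)).
Proof.
move=> Xr.
have v1 (n : nat) (A : flag X n) : \1%VF \in homs A A.
  by apply/memv_homs => i u uA; rewrite id_lfunE.
pose v : flag_homs X X := (vsproj _ \1%VF, vsproj _ \1%VF, vsproj _ \1%VF).
pose F (u : flag_homs X X) : 'End(X) := vsval u.1.1.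
have Fl : linear F by [].
have v0 : mismatch X (\1%VF : 'End(X)) \1%VF \1%VF v = 0.
  by rewrite mismatchE /mismatch_fun /= !vsprojK // !subrr.
have vi : lker (linfun F v) == 0%VS.
  by rewrite linfun_linear // /F /= vsprojK // lker0_id.
apply: generic_imp (generic_section (mismatch X gA gB gC) Xr v0 vi) => t [w].
rewrite -mismatch_pencil (linfun_linear Fl) => w0 wi cA cB cC.
have wker : w \in lker (mismatch X (\1%VF + t *: gA) (\1%VF + t *: gB)
  (\1%VF + t *: gC)).
  by rewrite memv_ker w0 eqxx.
have h := hom_moved cA cB cC wker.
apply: iso_inj (esym (dimvec_moved cA cB cC)) h _.
apply/lker0P => x y; rewrite !comp_lfunE => /(lker0P cA); exact: (lker0P wi).
Qed.

(** Each flag of X is carried to that of X' by a linear isomorphism. Interpolating these gives a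
    pencil of triples from X to X', whose generic member is isomorphic to X by openness at 0 and to
    X' by openness at 1. *)
Lemma rigid_unique X X' : rigid X -> rigid X' -> dimvec X = dimvec X' ->
  iso X X'.
Proof.
move=> Xr X'r XX'; have [/flag_conj[hA hA0 hAE] /flag_conj[hB hB0 hBE]] :=
  (proj1 (eq_dimvecP _ _) XX').
move=> /flag_conj[hC hC0 hCE].
have surj (h : 'Hom(X, X')) : lker h == 0%VS -> limg h = fullv.
  move=> /eqP h0; apply/eqP; rewrite eqEdim subvf /= limg_dim_eq ?h0 ?capv0 //.
  by rewrite (dimvec_dim XX').
have hVK (h : 'Hom(X, X')) : lker h == 0%VS -> cancel h^-1%VF h.
  by move=> h0 x; rewrite limg_lfunVK // surj // memvf.
(* Identifying the spaces by [hC], the pencil 1 + t(hC^-1 h - 1) leads from X to X' as t goes from 0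
   to 1; [a'] describes it from the other end. *)
pose a (h : 'Hom(X, X')) : 'End(X) := (hC^-1 \o h)%VF - \1%VF.
pose a' (h : 'Hom(X, X')) : 'End(X') := (hC \o h^-1)%VF - \1%VF.
have gen (Y : obj) (g : 'End(Y)) : generic (fun c =>
  lker (\1%VF + c *: g) == 0%VS).
  exact: generic_lker0 (lker0_id _).
have [t [[[[tA tB] tC] [[tA' tB'] tC']] [Xt X't]]] := generic_ex (generic_and
  (generic_and (generic_and (generic_and (gen X (a hA)) (gen X (a hB)))
    (gen X (a hC)))
   (generic_flip (generic_and (generic_and (gen X' (a' hA)) (gen X' (a' hB)))
     (gen X' (a' hC)))))
  (generic_and (rigid_open (a hA) (a hB) (a hC) Xr)
    (generic_flip (rigid_open (a' hA) (a' hB) (a' hC) X'r)))).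
apply: iso_trans (Xt tA tB tC) _.
apply: iso_trans (iso_sym (X't tA' tB' tC')).
apply: (@iso_inj _ _ _ _ (moved tA tB tC) (moved tA' tB' tC') hC) => //;
  first by rewrite !dimvec_moved.
(* The two descriptions of the pencil agree at t through [hC]: take u = h x and v = hC x. *)
have comb (u v : X') : v + t *: (u - v) = u + (1 - t) *: (v - u).
  rewrite scalerBl scale1r addrA (addrC u (v - u)) subrK.
  by rewrite -scalerN opprB.
have key (h : 'Hom(X, X')) n (A : flag X n) (A' : flag X' n) :
    lker h == 0%VS -> (forall i, (h @: A i)%VS = A' i) ->
    forall s (gs : limg (\1%VF + t *: a h) = fullv)
      (gs' : limg (\1%VF + (1 - t) *: a' h) = fullv),
    s = hC -> preserves s (flag_push A gs) (flag_push A' gs').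
  move=> h0 hE s gs gs' -> i y; rewrite !ffunE => /memv_imgP[x xA ->].
  rewrite -hE -limg_comp; apply/memv_imgP; exists x => //.
  rewrite !(comp_lfunE, add_lfunE, scale_lfunE, opp_lfunE, id_lfunE)
    lker0_lfunK //.
  rewrite linearD linearZ linearB /= hVK //.
apply/(@homP _ _ _ _ (moved tA tB tC) (moved tA' tB' tC')); split.
- exact: key hA0 hAE _ _ _ erefl.
- exact: key hB0 hBE _ _ _ erefl.
- exact: key hC0 hCE _ _ _ erefl.
Qed.

Lemma obj_exists (d : triple p q r) : Lambda d -> exists X, dimvec X = d.
Proof.
case: d => [[a b] c] [/= ab bc].
pose V : vectType K := 'rV[K]_(csize a).
have Vdim : \dim {:V} = csize a by rewrite dimvf /dim /= mul1n.
have [A Aa] := flag_exists Vdim; have [B Bb] := flag_exists (etrans Vdim ab).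
have [C Cc] := flag_exists (etrans Vdim (etrans ab bc)).
by exists (Obj A B C); rewrite /dimvec /= Aa Bb Cc.
Qed.

(** The projection onto a summand is an endomorphism, hence a scalar, so one of the two summands
    vanishes. *)
Lemma brick_indecomposable Y : \dim (hom_space Y Y) = 1%N -> indecomposable Y.
Proof.
move=> hom1.
have Y0 : \dim {:Y} != 0%N.
  apply/eqP => Y0; have : (\dim (hom_space Y Y) <= \dim {:'Hom(Y, Y)})%N.
    by rewrite dimvS ?subvf.
  by rewrite hom1 dimvf -[dim _]/(dim Y * dim Y)%N -dimvf Y0.
split=> [/iso_zeroP Y0'|Z Z' YZ]; first by rewrite Y0' in Y0.
have [f [g [fh gh fK gK]]] := (proj1 (isoP _ _)) YZ.
pose e := (g \o (pinl Z Z' \o pfst Z Z') \o f)%VF.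
have eh : e \in hom_space Y Y.
  by apply: (hom_comp (hom_comp gh (hom_comp (hom_inl _ _) (hom_fst _ _))) fh).
have scal : (hom_space Y Y <= <[\1%VF]>)%VS.
  have idsub : (<[\1%VF]> <= hom_space Y Y)%VS by rewrite -memvE hom_id.
  have /eqP-> : <[\1%VF]>%VS == hom_space Y Y; last exact: subvv.
  rewrite eqEdim idsub hom1 dim_vline lt0b.
  apply: contraNneq Y0 => id0; rewrite dimv_eq0 -subv0; apply/subvP => x _.
  by rewrite memv0 -[x]id_lfunE id0 zero_lfunE.
have /vlineP[c ec] := subvP scal _ eh.
have eE (z : Z) (z' : Z') : (z, 0) = (c *: z, c *: z') :> (Z * Z')%type.
  have := congr1 (fun h : 'End(Y) => f (h (g (z, z')))) ec.
  by rewrite scale_lfunE id_lfunE linearZ /= !comp_lfunE !gK pinlE pfstE.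
have [Z0|Z0] := classic (iso Z zero); first by left.
right; apply/iso_zeroP/eqP; rewrite dimv_eq0 -subv0; apply/subvP => z' _.
have [z z0] : exists z : Z, z != 0.
  apply: NNPP => no; apply: Z0; apply/iso_zeroP/eqP.
  rewrite dimv_eq0 -subv0; apply/subvP => z _; rewrite memv0.
  by apply: contraT => z0; case: no; exists z.
case: (eE z z') => zc /esym/eqP; rewrite scaler_eq0 memv0 => /predU1P[c0|//].
by rewrite zc c0 scale0r eqxx in z0.
Qed.

Lemma Pi_exists (d : triple p q r) : Pi K d ->
  exists X, indecomposable X /\ dimvec X = d.
Proof.
case=> dL dfin dt; have [X Xd] := obj_exists dL.
move: dfin; rewrite -Xd => /rigid_exists[Y YX Yr].
have /tits1P qY : tits (dimvec Y) = 1 by rewrite YX Xd.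
exists Y; split=> //; apply: brick_indecomposable.
by have := proj1 (proj2 (dim_hom_rigid Y)) Yr; rewrite qY; lia.
Qed.

Lemma dimvec_Lambda X : Lambda (dimvec X).
Proof. by split; rewrite !csize_flag_type. Qed.

(** Finite type is inherited by every summand, so each indecomposable summand is rigid with Q = 1,
    and [rigid_unique] identifies it with the chosen object of its dimension vector. *)
Lemma direct_sum_Pi (s : seq obj) X (I : triple p q r -> obj) :
  (forall d, Pi K d -> indecomposable (I d) /\ dimvec (I d) = d) ->
  List.Forall (@indecomposable K p q r) s -> iso X (direct_sum s) ->
  finite_type K (dimvec X) ->
  exists t : seq (triple p q r),
    (forall e, e \in t -> Pi K e) /\ iso X (direct_sum (map I t)).
Proof.
move=> IP; elim: s X => [|Y s IHs] X; first by move=> _ Xs _; exists [::].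
move=> /List.Forall_cons_iff[Yi si] /= XYs Xfin.
have Yfin := finite_type_iso_summand XYs Xfin.
have [Yr Yt] := indecomposable_rigid Yi Yfin.
have sfin : finite_type K (dimvec (direct_sum s)).
  by apply: finite_type_iso_summand Xfin; apply: iso_trans XYs (iso_sumC _ _).
have [t [tP st]] := IHs _ si (iso_refl _) sfin.
have YPi : Pi K (dimvec Y) by split=> //; apply: dimvec_Lambda.
exists (dimvec Y :: t); split=> [e|]; first by rewrite inE => /predU1P[->|/tP].
apply: iso_trans XYs _ => /=; apply: iso_sum st.
have [Ii Id] := IP _ YPi.
have [|Ir _] := indecomposable_rigid Ii; first by rewrite Id.
exact: rigid_unique.
Qed.

End Main.

Theorem theorem2p6 (K : closedFieldType) (p q r : nat)
    (hp : (0 < p)%N) (hq : (0 < q)%N) (hr : (0 < r)%N) :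
  exists I : triple p q r -> obj K p q r,
    (forall d : triple p q r, Pi K d ->
       [/\ indecomposable (I d), dimvec (I d) = d
         & forall X : obj K p q r,
             indecomposable X -> dimvec X = d -> iso X (I d)])
    /\
    (forall d : triple p q r, Lambda d -> finite_type K d ->
     forall X : obj K p q r, dimvec X = d ->
       exists s : seq (triple p q r),
         [/\ forall e, e \in s -> Pi K e,
             iso X (direct_sum (map I s))
           & forall s' : seq (triple p q r),
               (forall e, e \in s' -> Pi K e) ->
               iso X (direct_sum (map I s')) -> perm_eq s s']).
Proof.
(* Choice requires an object for every d; outside [Pi] nothing is demanded of it. *)
have ch (d : triple p q r) :
    exists X : obj K p q r, Pi K d -> indecomposable X /\ dimvec X = d.
  have [/Pi_exists[X XP]|no] := classic (Pi K d); first by exists X.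
  by exists (zero_obj K p q r).
pose I d := proj1_sig (constructive_indefinite_description _ (ch d)).
have IP d : Pi K d -> indecomposable (I d) /\ dimvec (I d) = d.
  by rewrite /I; case: constructive_indefinite_description.
exists I; split=> [d dP|d _ dfin X Xd].
  have [Ii Id] := IP d dP; split=> // X Xi Xd.
  have [_ dfin _] := dP.
  have [|Ir _] := indecomposable_rigid Ii; first by rewrite Id.
  have [|Xr _] := indecomposable_rigid Xi; first by rewrite Xd.
  by apply: rigid_unique => //; rewrite Id.
have [s [si Xs]] := krull_schmidt_exists X.
rewrite -Xd in dfin.
have [t [tP Xt]] := direct_sum_Pi IP si Xs dfin.
exists t; split=> // t' t'P Xt'.
apply: (@krull_schmidt_unique K p q r (p.-tuple nat * q.-tuple nat * r.-tuple
  nat)%type I (@Pi K p q r)) => //.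
- by move=> e /IP[].
(* The label d is recovered from I_d as its dimension vector. *)
- by move=> e e' /IP[_ {2}<-] /IP[_ {2}<-] /iso_dimvec.
exact: iso_trans (iso_sym Xt) Xt'.
Qed.
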